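(* Let $\mathcal C$ be a $2$-Calabi-Yau triangulated category over an algebraically closed field $k$, with suspension functor $\Sigma$ and with cluster-tilting objects. Let $L,N$ be two indecomposable rigid objects of $\mathcal C$. If $\dim_k\operatorname{Hom}_{\mathcal C}(L,\Sigma N)=1$, then $(L,N)$ is an exchange pair. Assume moreover that $\mathcal C$ admits a cluster structure; then $\dim_k\operatorname{Hom}_{\mathcal C}(L,\Sigma N)=1$ if and only if $(L,N)$ is an exchange pair.
   Context: $k$ is algebraically closed; $\mathcal C$ is a $k$-linear, Hom-finite, Krull–Schmidt triangulated category with suspension $\Sigma$, and $2$-Calabi-Yau means $\operatorname{Hom}_{\mathcal C}(X,Y)\cong D\operatorname{Hom}_{\mathcal C}(Y,\Sigma^2X)$ bifunctorially, where $D=\operatorname{Hom}_k(-,k)$. $\operatorname{add}M$ is the full subcategory of direct summands of finite direct sums of copies of $M$. An object $M$ is rigid if $\operatorname{Hom}_{\mathcal C}(M,\Sigma M)=0$. An object $T$ is cluster-tilting if it is rigid and $\operatorname{Hom}_{\mathcal C}(T,\Sigma Y)=0$ implies $Y\in\operatorname{add}T$. If $T=M\oplus\overline T$ is a basic cluster-tilting object with $M$ indecomposable, there is a unique (up to isomorphism) indecomposable object $M^*\not\cong M$ such that $\mu_M(T):=M^*\oplus\overline T$ is again a (basic) cluster-tilting object (Iyama–Yoshino); it is called the mutation of $T$ at $M$. In this situation $(M,M^* )$ is called an exchange pair. For a quiver $Q$ without loops or $2$-cycles with vertices $1,\dots,n$, $B(Q)=(b_{ij})$ is the skew-symmetric matrix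 with $b_{ij}=|\{\text{arrows }i\to j\}|-|\{\text{arrows }j\to i\}|$. For a basic cluster-tilting object $T$, $Q_T$ is the Gabriel quiver of $\operatorname{End}_{\mathcal C}(T)$. $\mathcal C$ admits a cluster structure if for each basic cluster-tilting object $T$ the quiver $Q_T$ has no loops and no $2$-cycles, and for each basic cluster-tilting $T=M\oplus\overline T$ with $M$ indecomposable, $B(Q_{\mu_M(T)})$ is the Fomin–Zelevinsky mutation of $B(Q_T)$ at the vertex $\ell$ corresponding to $M$: $b'_{ij}=-b_{ij}$ if $i=\ell$ or $j=\ell$, and $b'_{ij}=b_{ij}+[b_{i\ell}]_+b_{\ell j}+b_{i\ell}[-b_{\ell j}]_+$ otherwise, with $[b]_+=\max(b,0)$. *)

(* Defs.v *)
From mathcomp Require Import all_boot all_order all_algebra.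
From mathcomp Require Import boolp.

Set Implicit Arguments.
Unset Strict Implicit.
Unset Printing Implicit Defensive.

Import GRing.Theory Num.Theory.

Local Open Scope ring_scope.

Reserved Notation "g \oc f" (at level 40, left associativity).
Reserved Notation "X ~= Y" (at level 70, no associativity).

(* Hom-finiteness is built in: the morphism spaces are [vectType]s. *)
Record linCat (k : fieldType) := LinCat {
  ob :> Type;
  mor : ob -> ob -> vectType k;
  idm : forall X, mor X X;
  compm : forall X Y Z, mor Y Z -> mor X Y -> mor X Z;
  compm1l : forall X Y (f : mor X Y), compm (idm Y) f = f;
  compm1r : forall X Y (f : mor X Y), compm f (idm X) = f;
  compmA : forall X Y Z W (h : mor Z W) (g : mor Y Z) (f : mor X Y),
    compm h (compm g f) = compm (compm h g) f;
  compm_linearl : forall X Y Z (f : mor X Y),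
    linear (fun g : mor Y Z => compm g f);
  compm_linearr : forall X Y Z (g : mor Y Z),
    linear (fun f : mor X Y => compm g f)
}.

Arguments mor {k l} X Y.
Arguments idm {k l} X.
Arguments compm {k l X Y Z} g f.

Notation "g \oc f" := (compm g f) : ring_scope.

Section Additive.
Variables (k : fieldType) (C : linCat k).
Implicit Types X Y Z : C.

Definition is_iso X Y (f : mor X Y) : Prop :=
  exists g : mor Y X, g \oc f = idm X /\ f \oc g = idm Y.

Definition isomorphic X Y : Prop := exists f : mor X Y, is_iso f.

Definition is_zero X : Prop := idm X = 0.

Record biprod X Y Z := Biprod {
  binl : mor X Z;
  binr : mor Y Z;
  bprl : mor Z X;
  bprr : mor Z Y;
  bprl_inl : bprl \oc binl = idm X;
  bprr_inr : bprr \oc binr = idm Y;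
  bprl_inr : bprl \oc binr = 0;
  bprr_inl : bprr \oc binl = 0;
  bin_pr : binl \oc bprl + binr \oc bprr = idm Z
}.

Record dirsum n (F : 'I_n -> C) X := Dirsum {
  dinj : forall i, mor (F i) X;
  dprj : forall i, mor X (F i);
  dprj_inj : forall i, dprj i \oc dinj i = idm (F i);
  dprj_inj0 : forall i j, i != j -> dprj j \oc dinj i = 0;
  dinj_prj : \sum_(i < n) dinj i \oc dprj i = idm X
}.

Definition is_biprod X Y Z : Prop := inhabited (biprod X Y Z).
Definition is_dirsum n (F : 'I_n -> C) X : Prop := inhabited (dirsum F X).

Definition in_add M X : Prop :=
  exists n Y Z, is_dirsum (fun _ : 'I_n => M) Y /\ is_biprod X Z Y.

Definition indecomposable X : Prop :=
  ~ is_zero X /\ (forall Y Z, is_biprod Y Z X -> is_zero Y \/ is_zero Z).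

(* The ring [mor X X] is local: it is nonzero and its non-units are closed
   under addition. *)
Definition local_end X : Prop :=
  idm X <> 0 /\
  (forall f g : mor X X, ~ is_iso f -> ~ is_iso g -> ~ is_iso (f + g)).

Definition krull_schmidt : Prop :=
  forall X, exists n (F : 'I_n -> C),
    is_dirsum F X /\ (forall i, local_end (F i)).

Definition basic_family n (F : 'I_n -> C) : Prop :=
  (forall i, indecomposable (F i)) /\
  (forall i j, isomorphic (F i) (F j) -> i = j).

Definition basic X : Prop :=
  exists n (F : 'I_n -> C), is_dirsum F X /\ basic_family F.

End Additive.

Notation "X ~= Y" := (isomorphic X Y) : ring_scope.

Section GabrielQuiver.
Variables (k : fieldType) (C : linCat k).

(* The span of the composites [g \oc f] with [g \in U] and [f \in V]. *)
Definition compv (X Y Z : C) (U : {vspace mor Y Z}) (V : {vspace mor X Y}) :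
    {vspace mor X Z} :=
  <<[seq g \oc f | g <- vbasis U, f <- vbasis V]>>%VS.

(* Every left ideal of the unital algebra [mor T T] is a subspace. *)
Definition left_ideal (T : C) (I : {vspace mor T T}) : Prop :=
  forall f g : mor T T, g \in I -> f \oc g \in I.

Definition maximal_left_ideal (T : C) (I : {vspace mor T T}) : Prop :=
  [/\ left_ideal I, I <> fullv &
      forall I' : {vspace mor T T},
        left_ideal I' -> (I <= I')%VS -> I' = I \/ I' = fullv].

Lemma bigcap_vspaceP (V : vectType k) (P : {vspace V} -> Prop) :
  exists J : {vspace V}, forall v, v \in J <-> (forall I, P I -> v \in I).
Proof.
suff H n (J : {vspace V}) : (\dim J <= n)%N ->
    (forall v, (forall I, P I -> v \in I) -> v \in J) ->
    exists J : {vspace V}, forall v, v \in J <-> (forall I, P I -> v \in I).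
  by apply: (H _ fullv (leqnn _)) => v _; rewrite memvf.
elim: n J => [|n IHn] J leJn subJ;
  have [allI|/existsNP[I /not_implyP[PI /negP nJI]]] :=
    pselect (forall I, P I -> (J <= I)%VS).
- exists J => v; split=> [vJ I PI|]; last exact: subJ.
  exact: subvP (allI I PI) v vJ.
- by case/negP: nJI; move: leJn; rewrite leqn0 dimv_eq0 => /eqP->; rewrite sub0v.
- exists J => v; split=> [vJ I PI|]; last exact: subJ.
  exact: subvP (allI I PI) v vJ.
- apply: (IHn (J :&: I)%VS) => [|v vI]; last by rewrite memv_cap subJ ?vI.
  rewrite -ltnS (leq_trans _ leJn) // (ltn_leqif (dimv_leqif_sup (capvSl J I))).
  by rewrite subv_cap subvv.
Qed.

(* The Jacobson radical of [mor T T]. *)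
Definition jacobson (T : C) : {vspace mor T T} :=
  sval (cid (bigcap_vspaceP (@maximal_left_ideal T))).

Lemma mem_jacobson (T : C) (f : mor T T) :
  f \in jacobson T <->
  (forall I : {vspace mor T T}, maximal_left_ideal I -> f \in I).
Proof. by rewrite /jacobson; case: cid. Qed.

Section Arrows.
Variables (n : nat) (F : 'I_n -> C) (T : C) (d : dirsum F T).

Definition idem (i : 'I_n) : mor T T := dinj d i \oc dprj d i.

Definition corner (U : {vspace mor T T}) (i j : 'I_n) : {vspace mor T T} :=
  compv <[idem j]> (compv U <[idem i]>).

(* Number of arrows from [i] to [j] in the Gabriel quiver of [mor T T], when
   [F] is a basic family: the dimension of e_j (J / J^2) e_i.  Numbering the
   arrows with the opposite orientation changes the sign of [exchange_matrix],
   which commutes with [mutate]. *)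
Definition arrows (i j : 'I_n) : nat :=
  \dim (corner (jacobson T) i j)
  - \dim (corner (compv (jacobson T) (jacobson T)) i j).

Definition no_loops : Prop := forall i, arrows i i = 0%N.
Definition no_2cycles : Prop :=
  forall i j, i != j -> ~ ((0 < arrows i j)%N /\ (0 < arrows j i)%N).

Definition exchange_matrix : 'M[int]_n :=
  \matrix_(i, j) ((arrows i j)%:Z - (arrows j i)%:Z).

End Arrows.

End GabrielQuiver.

(* Fomin-Zelevinsky matrix mutation. *)
Definition mutate n (l : 'I_n) (B : 'M[int]_n) : 'M[int]_n :=
  \matrix_(i, j)
    if (i == l) || (j == l) then - B i j
    else B i j + Num.max (B i l) 0 * B l j + B i l * Num.max (- B l j) 0.

Record triCat (k : fieldType) := TriCat {
  tri_lin :> linCat k;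
  zero_ex : exists X : tri_lin, is_zero X;
  biprod_ex : forall X Y : tri_lin, exists Z, is_biprod X Y Z;

  susp : tri_lin -> tri_lin;
  suspm : forall X Y : tri_lin, mor X Y -> mor (susp X) (susp Y);
  suspm1 : forall X, suspm (idm X) = idm (susp X);
  suspmM : forall X Y Z (g : mor Y Z) (f : mor X Y),
    suspm (g \oc f) = suspm g \oc suspm f;
  suspm_linear : forall X Y, linear (@suspm X Y);
  suspm_bij : forall X Y, bijective (@suspm X Y);
  susp_esssurj : forall Y, exists X, isomorphic (susp X) Y;

  (* [dtri u v w]: X -u-> Y -v-> Z -w-> susp X is a distinguished triangle *)
  dtri : forall X Y Z : tri_lin, mor X Y -> mor Y Z -> mor Z (susp X) -> Prop;
  (* TR1 *)
  dtri_iso : forall X Y Z X' Y' Z'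
      (u : mor X Y) (v : mor Y Z) (w : mor Z (susp X))
      (u' : mor X' Y') (v' : mor Y' Z') (w' : mor Z' (susp X'))
      (a : mor X X') (b : mor Y Y') (c : mor Z Z'),
    is_iso a -> is_iso b -> is_iso c ->
    b \oc u = u' \oc a -> c \oc v = v' \oc b -> suspm a \oc w = w' \oc c ->
    dtri u v w -> dtri u' v' w';
  dtri_id : forall X Z : tri_lin, is_zero Z ->
    dtri (idm X) (0 : mor X Z) (0 : mor Z (susp X));
  dtri_cone : forall X Y (u : mor X Y),
    exists Z (v : mor Y Z) (w : mor Z (susp X)), dtri u v w;
  (* TR2 *)
  dtri_rot : forall X Y Z (u : mor X Y) (v : mor Y Z) (w : mor Z (susp X)),
    dtri u v w <-> dtri v w (- suspm u);
  (* TR3 *)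
  dtri_mor : forall X Y Z X' Y' Z'
      (u : mor X Y) (v : mor Y Z) (w : mor Z (susp X))
      (u' : mor X' Y') (v' : mor Y' Z') (w' : mor Z' (susp X'))
      (a : mor X X') (b : mor Y Y'),
    dtri u v w -> dtri u' v' w' -> b \oc u = u' \oc a ->
    exists c : mor Z Z', c \oc v = v' \oc b /\ suspm a \oc w = w' \oc c;
  (* TR4, the octahedral axiom *)
  dtri_oct : forall X Y Z X' Y' Z' (u : mor X Y) (v : mor Y Z)
      (a : mor Y Z') (a' : mor Z' (susp X))
      (b : mor Z X') (b' : mor X' (susp Y))
      (c : mor Z Y') (c' : mor Y' (susp X)),
    dtri u a a' -> dtri v b b' -> dtri (v \oc u) c c' ->
    exists (f : mor Z' Y') (g : mor Y' X'),
      dtri f g (suspm a \oc b') /\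
      [/\ f \oc a = c \oc v, c' \oc f = a', g \oc c = b &
          b' \oc g = suspm u \oc c']
}.

Arguments susp {k t} X.
Arguments suspm {k t X Y} f.
Arguments dtri {k t X Y Z} u v w.

Section ClusterTilting.
Variables (k : fieldType) (C : triCat k).
Implicit Types X Y M T L N : C.

(* [phi X Y] is the isomorphism from Hom(X, Y) to the dual of
   Hom(Y, susp (susp X)). *)
Definition two_calabi_yau : Prop :=
  exists phi : forall X Y,
      mor X Y -> 'Hom(mor Y (susp (susp X)), (k^o : vectType k)),
    [/\ forall X Y, linear (@phi X Y),
        forall X Y, bijective (@phi X Y) &
        forall X X' Y Y' (f : mor X' X) (g : mor Y Y') (h : mor X Y)
            (t : mor Y' (susp (susp X'))),
          phi X' Y' (g \oc h \oc f) t =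
          phi X Y h (suspm (suspm f) \oc t \oc g)].

Definition rigid M : Prop := forall f : mor M (susp M), f = 0.

Definition cluster_tilting T : Prop :=
  rigid T /\
  (forall Y, (forall f : mor T (susp Y), f = 0) -> in_add T Y).

(* T = M (+) Tb and T' = M' (+) Tb is the mutation of T at M. *)
Definition mutation M Tb T M' T' : Prop :=
  [/\ indecomposable M /\ indecomposable M',
      is_biprod M Tb T /\ is_biprod M' Tb T',
      basic T /\ cluster_tilting T,
      basic T' /\ cluster_tilting T' &
      ~ M ~= M'].

Definition exchange_pair M M' : Prop :=
  exists Tb T T', mutation M Tb T M' T'.

(* The vertices of the quivers of T and of its mutation T' are identified so
   that M and M' both correspond to [l] and the indecomposable summands of Tb
   keep their index. *)
Definition cluster_structure : Prop :=
  (forall T n (F : 'I_n -> C) (d : dirsum F T),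
     cluster_tilting T -> basic_family F -> no_loops d /\ no_2cycles d) /\
  (forall T T' Tb n (F F' : 'I_n -> C) (d : dirsum F T) (d' : dirsum F' T')
      (l : 'I_n),
     basic_family F -> basic_family F' ->
     mutation (F l) Tb T (F' l) T' ->
     (forall i, i != l -> F i ~= F' i) ->
     exchange_matrix d' = mutate l (exchange_matrix d)).

End ClusterTilting.

(* Main.v *)
(* Write Ext(X, Y) for Hom(X, susp Y).
   If Ext(L, N) is one-dimensional, so is Ext(N, L), and the two nonsplit
   triangles N -> E -> L -> susp N and L -> E' -> N -> susp L have middle terms
   with no extensions among E, E', L and among E, E', N.  The rigid object
   L (+) E (+) E' has a Bongartz-type completion to a basic cluster-tilting
   object L (+) Tb.  If a map X -> susp N, with X having no extensions with E
   and E', is nonzero, then Calabi-Yau duality makes L a summand of X; applied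
   to Tb this shows that N (+) Tb is rigid, and applied with L and N exchanged
   that it is cluster-tilting.
   Conversely, absence of loops means that the radical of End(L) factors through
   add Tb (Nakayama), and likewise for N, so both radicals act by zero on
   Ext(N, L).  A basis of Ext(N, L), of size m, gives a triangle
   L^m -> D -> N -> susp L^m with Ext(N, D) = 0, so the field k = End(N)/rad
   surjects onto Ext(N, L)^m, which forces m <= 1. *)
From HB Require Import structures.
Require Import Defs.
From mathcomp Require Import all_boot all_order all_algebra.
From mathcomp Require Import boolp.

Set Implicit Arguments.
Unset Strict Implicit.
Unset Printing Implicit Defensive.

Import GRing.Theory.

Local Open Scope ring_scope.

(** * Linear algebra: subspaces given by predicates, induction on codimension *)

Section Subspaces.
Variables (k : fieldType).

Lemma linear_morph (U V : lmodType k) (f : U -> V) (lf : linear f) :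
  [/\ f 0 = 0, {morph f : x y / x + y}, {morph f : x / - x},
      {morph f : x y / x - y} & forall a, {morph f : x / a *: x}].
Proof.
pose F : {linear U -> V} := HB.pack f (GRing.isLinear.Build k U V _ f lf).
split; [exact: (linear0 F) | exact: (linearD F) | exact: (linearN F)
       | exact: (linearB F) | exact: (linearZ_LR F)].
Qed.

Lemma dim_bij (U V : vectType k) (f : U -> V) :
  linear f -> bijective f -> \dim {:U} = \dim {:V}.
Proof.
move=> lf bf; pose F : {linear U -> V} := HB.pack f (GRing.isLinear.Build k U V _ f lf).
have FE x : linfun F x = f x by rewrite lfunE.
have kerF : lker (linfun F) = 0%VS.
  by apply/eqP/lker0P => x y; rewrite !FE; exact: bij_inj bf _ _.
rewrite -(limg_dim_eq (f := linfun F)) ?kerF ?capv0 //; congr (\dim _).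
apply/eqP; rewrite eqEsubv subvf /=; apply/subvP => v _; case: bf => g _ gK.
by rewrite -(gK v) -FE; apply/memv_img/memvf.
Qed.

(** Adding to a subspace inside [P] a vector of [P] that it misses lowers the codimension, so the
    process stops. This turns conditions stated in [Prop] into subspaces, where sums and spans can
    be handled. *)
Lemma vspace_of_closed (V : vectType k) (P : V -> Prop) :
  P 0 -> (forall a u v, P u -> P v -> P (a *: u + v)) ->
  exists W : {vspace V}, forall v, v \in W <-> P v.
Proof.
move=> P0 PD.
suff H n (W : {vspace V}) : (\dim {:V} - \dim W <= n)%N ->
    (forall v, v \in W -> P v) -> exists W : {vspace V}, forall v, v \in W <-> P v.
  by apply: (H _ 0%VS (leqnn _)) => v; rewrite memv0 => /eqP->.
elim: n W => [|n IHn] W leWn subW.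
  exists W => v; split=> [|_]; first exact: subW.
  suff -> : W = fullv by rewrite memvf.
  by apply/eqP; rewrite eqEdim subvf /= -subn_eq0 -leqn0.
have [allP|/existsNP[v /not_implyP[Pv /negP nWv]]] :=
  pselect (forall v, P v -> v \in W).
  by exists W => v; split; [exact: subW | exact: allP].
apply: (IHn (W + <[v]>)%VS).
  rewrite -ltnS (leq_trans _ leWn) //; apply: ltn_sub2l.
    rewrite (ltn_leqif (dimv_leqif_sup (subvf W))).
    by apply: contra nWv => /subvP->; rewrite ?memvf.
  rewrite (ltn_leqif (dimv_leqif_sup (addvSl _ _))); apply: contra nWv => /subvP->//.
  by apply: (subvP (addvSr _ _)); rewrite memv_line.
move=> x /memv_addP[w /subW Pw [_ /vlineP[a ->] ->]].
by rewrite addrC; apply: PD.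
Qed.

Lemma vspace_codim_ind (V : vectType k) (P : {vspace V} -> Prop) :
  (forall W : {vspace V},
     (forall W' : {vspace V}, (W <= W')%VS -> ~~ (W' <= W)%VS -> P W') -> P W) ->
  forall W, P W.
Proof.
move=> IH W; have [n] := ubnP (\dim {:V} - \dim W).
elim: n W => // n IHn W ltWn; apply: IH => W' sWW' nsW'W; apply: IHn.
rewrite -ltnS; apply: leq_trans ltWn; rewrite ltnS; apply: ltn_sub2l.
  rewrite (ltn_leqif (dimv_leqif_sup (subvf W))).
  by apply: contra nsW'W; apply: subv_trans (subvf _).
by rewrite (ltn_leqif (dimv_leqif_sup sWW')).
Qed.

End Subspaces.

(** * Ideals of maps and additive closures *)

Section Composition.
Variables (k : fieldType) (C : linCat k).
Implicit Types X Y Z W M : C.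

Section Morph.
Variables X Y Z : C.
Implicit Types (f : mor X Y) (g : mor Y Z).

Lemma comp0m f : (0 : mor Y Z) \oc f = 0.
Proof. by have [] := linear_morph (compm_linearl (Z := Z) f). Qed.
Lemma compm0 g : g \oc (0 : mor X Y) = 0.
Proof. by have [] := linear_morph (compm_linearr (X := X) g). Qed.
Lemma compDm f : {morph (fun g => g \oc f) : g h / g + h}.
Proof. by have [] := linear_morph (compm_linearl (Z := Z) f). Qed.
Lemma compmD g : {morph (fun f => g \oc f) : f h / f + h}.
Proof. by have [] := linear_morph (compm_linearr (X := X) g). Qed.
Lemma compNm f : {morph (fun g => g \oc f) : g / - g}.
Proof. by have [] := linear_morph (compm_linearl (Z := Z) f). Qed.
Lemma compmN g : {morph (fun f => g \oc f) : f / - f}.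
Proof. by have [] := linear_morph (compm_linearr (X := X) g). Qed.
Lemma compBm f : {morph (fun g => g \oc f) : g h / g - h}.
Proof. by have [] := linear_morph (compm_linearl (Z := Z) f). Qed.
Lemma compmB g : {morph (fun f => g \oc f) : f h / f - h}.
Proof. by have [] := linear_morph (compm_linearr (X := X) g). Qed.
Lemma compZm a f : {morph (fun g => g \oc f) : g / a *: g}.
Proof. by have [] := linear_morph (compm_linearl (Z := Z) f). Qed.
Lemma compmZ a g : {morph (fun f => g \oc f) : f / a *: f}.
Proof. by have [] := linear_morph (compm_linearr (X := X) g). Qed.
Lemma comp_sumr I (r : seq I) (P : pred I) (F : I -> mor X Y) g :
  g \oc (\sum_(i <- r | P i) F i) = \sum_(i <- r | P i) (g \oc F i).
Proof. exact: (big_morph _ (compmD g) (compm0 g)). Qed.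
Lemma comp_suml I (r : seq I) (P : pred I) (F : I -> mor Y Z) f :
  (\sum_(i <- r | P i) F i) \oc f = \sum_(i <- r | P i) (F i \oc f).
Proof. exact: (big_morph _ (compDm f) (comp0m f)). Qed.

Variables (U : {vspace mor Y Z}) (V : {vspace mor X Y}).

(** [P] is membership in some subspace, and a subspace contains a span once it contains the
    generators. *)
Lemma compv_ind (P : mor X Z -> Prop) :
  P 0 -> (forall a u v, P u -> P v -> P (a *: u + v)) ->
  (forall g f, g \in U -> f \in V -> P (g \oc f)) ->
  forall x, x \in compv U V -> P x.
Proof.
move=> P0 PD PC x; have [W WP] := vspace_of_closed P0 PD.
move=> xUV; apply/WP; apply: subvP xUV; apply/span_subvP => y.
by case/allpairsP=> -[g f] [/= gU fV ->]; apply/WP/PC; exact: vbasis_mem.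
Qed.

Lemma mem_compv g f : g \in U -> f \in V -> g \oc f \in compv U V.
Proof.
move=> /coord_vbasis-> /coord_vbasis->; rewrite comp_suml rpred_sum // => i _.
rewrite comp_sumr rpred_sum // => j _; rewrite compZm compmZ !rpredZ //.
by apply/memv_span/allpairs_f; apply: mem_nth; rewrite size_tuple.
Qed.

End Morph.

(** Finite sums of composites through [M] stand for maps factoring through a finite direct sum of
    copies of [M], so the ideal of such maps is a subspace and no direct sum has to be chosen. *)
Definition thru M X Y : {vspace mor X Y} :=
  compv (fullv : {vspace mor M Y}) (fullv : {vspace mor X M}).

Lemma mem_thru M X Y (g : mor M Y) (f : mor X M) : g \oc f \in thru M X Y.
Proof. by apply: mem_compv; rewrite memvf. Qed.

Lemma thru_ind M X Y (P : mor X Y -> Prop) :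
  P 0 -> (forall a u v, P u -> P v -> P (a *: u + v)) ->
  (forall (g : mor M Y) (f : mor X M), P (g \oc f)) ->
  forall x, x \in thru M X Y -> P x.
Proof. by move=> P0 PD PC; apply: compv_ind => // g f _ _; apply: PC. Qed.

Lemma thru_compl M X Y Z (g : mor Y Z) x :
  x \in thru M X Y -> g \oc x \in thru M X Z.
Proof.
move: x; apply: thru_ind => [|a u v Hu Hv|h f]; first by rewrite compm0 mem0v.
  by rewrite compmD compmZ rpredD ?rpredZ.
by rewrite compmA mem_thru.
Qed.

Lemma thru_compr M X Y Z (f : mor X Y) x :
  x \in thru M Y Z -> x \oc f \in thru M X Z.
Proof.
move: x; apply: thru_ind => [|a u v Hu Hv|h g]; first by rewrite comp0m mem0v.
  by rewrite compDm compZm rpredD ?rpredZ.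
by rewrite -compmA mem_thru.
Qed.

(** Working form of [in_add]; [in_addP] shows that they agree in a triangulated category. *)
Definition inadd M X := idm X \in thru M X X.

Lemma inadd_thru M Y X Z x : inadd M Y -> x \in thru Y X Z -> x \in thru M X Z.
Proof.
move=> MY; move: x; apply: thru_ind => [|a u v Hu Hv|g f]; first exact: mem0v.
  by rewrite rpredD ?rpredZ.
by rewrite -[f]compm1l; apply/thru_compl/thru_compr.
Qed.

Lemma inadd_trans M Y X : inadd M Y -> inadd Y X -> inadd M X.
Proof. exact: inadd_thru. Qed.

Definition retract X Y := exists f : mor X Y, exists g : mor Y X, g \oc f = idm X.

Lemma inadd_retract M X : retract X M -> inadd M X.
Proof. by case=> f [g gf]; rewrite /inadd -gf mem_thru. Qed.

Lemma retract_refl X : retract X X.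
Proof. by exists (idm X), (idm X); rewrite compm1l. Qed.

Lemma inadd_refl X : inadd X X. Proof. exact/inadd_retract/retract_refl. Qed.

Lemma retract_trans X Y Z : retract X Y -> retract Y Z -> retract X Z.
Proof.
case=> f [g gf] [f' [g' gf']]; exists (f' \oc f), (g \oc g').
by rewrite compmA -(compmA g) gf' compm1r gf.
Qed.

Lemma iso_retract X Y : X ~= Y -> retract X Y /\ retract Y X.
Proof. by case=> f [g [gf fg]]; split; [exists f, g | exists g, f]. Qed.

Lemma iso_refl X : X ~= X.
Proof. by exists (idm X), (idm X); rewrite compm1l. Qed.

Lemma iso_sym X Y : X ~= Y -> Y ~= X.
Proof. by case=> f [g [gf fg]]; exists g, f. Qed.

Lemma iso_trans X Y Z : X ~= Y -> Y ~= Z -> X ~= Z.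
Proof.
case=> f [g [gf fg]] [f' [g' [gf' fg']]]; exists (f' \oc f), (g \oc g').
split; rewrite compmA; first by rewrite -(compmA g) gf' compm1r gf.
by rewrite -(compmA f') fg compm1r fg'.
Qed.

Section Biprod.
Variables (A B Z : C) (b : biprod A B Z).

Lemma biprod_retractl : retract A Z.
Proof. by exists (binl b), (bprl b); rewrite bprl_inl. Qed.
Lemma biprod_retractr : retract B Z.
Proof. by exists (binr b), (bprr b); rewrite bprr_inr. Qed.

Lemma biprod_thru X Y x :
  x \in thru Z X Y -> exists u v, [/\ u \in thru A X Y, v \in thru B X Y & x = u + v].
Proof.
move=> xZ; suff /memv_addP[u uA [v vB ->]] : x \in (thru A X Y + thru B X Y)%VS by exists u, v.
move: x xZ; apply: thru_ind => [|a u v Hu Hv|g f]; first exact: mem0v.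
  by rewrite rpredD ?rpredZ.
rewrite -[f]compm1l -(bin_pr b) compDm compmD -!compmA !(compmA g).
by apply/memv_add; apply: mem_thru.
Qed.

Lemma inadd_biprod M : inadd M A -> inadd M B -> inadd M Z.
Proof.
move=> MA MB; rewrite /inadd -(bin_pr b).
by apply: rpredD; [apply: inadd_thru MA _|apply: inadd_thru MB _]; exact: mem_thru.
Qed.

End Biprod.

Section Dirsum.
Variables (n : nat) (F : 'I_n -> C) (Z : C) (d : dirsum F Z).

Lemma dirsum_retract i : retract (F i) Z.
Proof. by exists (dinj d i), (dprj d i); rewrite dprj_inj. Qed.

Lemma inadd_dirsum M : (forall i, inadd M (F i)) -> inadd M Z.
Proof.
move=> MF; rewrite /inadd -(dinj_prj d); apply: rpred_sum => i _.
by apply: inadd_thru (MF i) _; apply: mem_thru.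
Qed.

End Dirsum.

(** * Local endomorphism rings *)

Lemma is_iso_id X : is_iso (idm X).
Proof. by exists (idm X); rewrite compm1l. Qed.

Lemma is_iso_comp X Y Z (g : mor Y Z) (f : mor X Y) :
  is_iso g -> is_iso f -> is_iso (g \oc f).
Proof.
case=> g' [gg' g'g] [f' [ff' f'f]]; exists (f' \oc g'); split; rewrite compmA.
  by rewrite -(compmA f') gg' compm1r ff'.
by rewrite -(compmA g) f'f compm1r g'g.
Qed.

Lemma is_isoZ X Y a (f : mor X Y) : a != 0 -> is_iso f -> is_iso (a *: f).
Proof.
move=> a0 [g [gf fg]]; exists (a^-1 *: g).
by rewrite !compZm !compmZ !scalerA mulVf // mulfV // !scale1r.
Qed.

Section Local.
Variables (X : C) (locX : local_end X).

Lemma local_not_iso0 : ~ is_iso (0 : mor X X).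
Proof. by case=> g [+ _]; rewrite compm0 => /esym; case: locX. Qed.

(** The endomorphism [f \oc g] is idempotent. In a local ring it or its complement is a unit; if the
    complement is, then [f = 0], which contradicts [idm X <> 0]. *)
Lemma local_linv (f g : mor X X) : g \oc f = idm X -> is_iso f /\ is_iso g.
Proof.
move=> gf; suff fg : f \oc g = idm X by split; [exists g | exists f].
have [[h [hfg fgh]]|nu] := pselect (is_iso (f \oc g)).
  by rewrite -hfg -[in RHS](compm1r f) -[in RHS]gf !compmA -(compmA _ f g) -(compmA h) hfg compm1l.
have [[h [+ _]]|nu'] := pselect (is_iso (idm X - f \oc g)).
  move=> hfg; have f0 : f = 0.
    by rewrite -[f]compm1l -hfg -compmA compBm compm1l -compmA gf compm1r subrr compm0.
  by case: locX => /[!(esym gf)]; rewrite f0 compm0.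
by case: locX => _ /(_ _ _ nu nu'); rewrite addrC subrK => /(_ (is_iso_id X)).
Qed.

Lemma local_nonunits : exists J : {vspace mor X X}, forall f, f \in J <-> ~ is_iso f.
Proof.
apply: vspace_of_closed => [|a u v nu nv]; first exact: local_not_iso0.
have [->|a0] := eqVneq a 0; first by rewrite scale0r add0r.
case: locX => _; apply=> // /(is_isoZ (a := a^-1)); rewrite invr_neq0 // => /(_ isT).
by rewrite scalerA mulVf // scale1r.
Qed.

Lemma local_nonunitM (f g : mor X X) : ~ is_iso f \/ ~ is_iso g -> ~ is_iso (g \oc f).
Proof.
move=> nfg [h [hgf gfh]].
rewrite compmA in hgf; rewrite -compmA in gfh.
by have [[uf _] [_ ug]] := (local_linv hgf, local_linv gfh); case: nfg.
Qed.

Lemma local_sub1 (f : mor X X) : ~ is_iso f -> is_iso (idm X - f).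
Proof.
move=> nf; apply: contrapT => n1f; case: locX => _ /(_ _ _ nf n1f).
by rewrite addrC subrK => /(_ (is_iso_id X)).
Qed.

(** An invertible composite through [M] would make [X] a retract of [M]; sums of composites follow
    because the nonunits form a subspace. *)
Lemma thru_nonunit M (x : mor X X) : ~ retract X M -> x \in thru M X X -> ~ is_iso x.
Proof.
move=> nXM; have [J JP] := local_nonunits; move=> xM; apply/JP; move: x xM.
apply: thru_ind => [|a u v Hu Hv|g f]; first exact: mem0v.
  by rewrite rpredD ?rpredZ.
by apply/JP => -[h [hgf _]]; apply: nXM; exists f, (h \oc g); rewrite -compmA.
Qed.

Lemma local_inadd M : inadd M X -> retract X M.
Proof.
by move=> MX; apply: contrapT => /thru_nonunit /(_ MX) /(_ (is_iso_id X)).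
Qed.

(** The identity of [X] splits into a part through [A] and a part through [B], and two nonunits
    cannot add up to a unit. *)
Lemma local_biprod A B Z : biprod A B Z -> retract X Z -> retract X A \/ retract X B.
Proof.
move=> b /inadd_retract/(biprod_thru b)[u [v [uA vB e]]].
have [|nA] := pselect (retract X A); [by left | right].
apply: contrapT => /thru_nonunit /(_ vB) nv.
case: locX => _ /(_ _ _ (thru_nonunit nA uA) nv); rewrite -e.
by move=> /(_ (is_iso_id X)).
Qed.

Lemma local_dirsum n (F : 'I_n -> C) Z (d : dirsum F Z) :
  retract X Z -> exists i, retract X (F i).
Proof.
case=> f [g gf]; have [J JP] := local_nonunits.
apply: contrapT => nF; have /JP[] : idm X \in J; last exact: is_iso_id.
rewrite -gf -[f]compm1l -(dinj_prj d) comp_suml comp_sumr; apply: rpred_sum => i _.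
apply/JP => -[h [hgf _]]; apply: nF; exists i, (dprj d i \oc f), (h \oc (g \oc dinj d i)).
by rewrite -hgf !compmA.
Qed.

Lemma local_section_inv Y (f : mor X Y) (g : mor Y X) :
  local_end Y -> g \oc f = idm X -> f \oc g = idm Y.
Proof.
move=> locY gf.
have fg2 : (f \oc g) \oc (f \oc g) = f \oc g by rewrite compmA -(compmA f) gf compm1r.
have [[h [hfg _]]|nu] := pselect (is_iso (f \oc g)).
  by rewrite -(compm1l (f \oc g)) -hfg -compmA fg2.
have [[h [h1 _]]|nu'] := pselect (is_iso (idm Y - f \oc g)).
  have e : f \oc g = 0.
    by rewrite -[f \oc g]compm1l -h1 -compmA compBm compm1l fg2 subrr compm0.
  case: locX => + _; case.
  by rewrite -gf -[f]compm1r -gf (compmA f) e comp0m compm0.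
by case: locY => _ /(_ _ _ nu nu'); rewrite addrC subrK => /(_ (is_iso_id Y)).
Qed.

Lemma local_retract_iso Y : local_end Y -> retract X Y -> X ~= Y.
Proof. by move=> locY [f [g gf]]; exists f, g; split=> //; exact: local_section_inv. Qed.

(** The two idempotents of a decomposition are orthogonal with sum the identity, so one is a unit
    and the other vanishes. *)
Lemma local_indecomposable : indecomposable X.
Proof.
split=> [X0|Y Z [b]]; first by case: locX.
have e0 : (binl b \oc bprl b) \oc (binr b \oc bprr b) = 0.
  by rewrite compmA -(compmA (binl b)) bprl_inr compm0 comp0m.
have [[h [h1 _]]|nu] := pselect (is_iso (binl b \oc bprl b)).
  right; have e : binr b \oc bprr b = 0.
    by rewrite -[LHS]compm1l -h1 -compmA e0 compm0.
  rewrite /is_zero -(bprr_inr b) -[binr b]compm1r -(bprr_inr b).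
  by rewrite (compmA (binr b)) e comp0m compm0.
have [[h [_ h1]]|nu'] := pselect (is_iso (binr b \oc bprr b)).
  left; have e : binl b \oc bprl b = 0.
    by rewrite -[LHS]compm1r -h1 compmA e0 comp0m.
  rewrite /is_zero -(bprl_inl b) -[binl b]compm1r -(bprl_inl b).
  by rewrite (compmA (binl b)) e comp0m compm0.
by case: locX => _ /(_ _ _ nu nu'); rewrite bin_pr => /(_ (is_iso_id X)).
Qed.

End Local.

Lemma local_iso X Y : X ~= Y -> local_end X -> local_end Y.
Proof.
move=> [f [g [gf fg]]] [id0 addX]; split.
  by move=> Y0; apply: id0; rewrite -gf -[f]compm1l Y0 comp0m compm0.
have tr (x : mor Y Y) : is_iso x <-> is_iso (g \oc x \oc f).
  split=> [ux|[z [zx xz]]].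
    by apply: is_iso_comp; [apply: is_iso_comp => //; exists f | exists g].
  have -> : x = f \oc (g \oc x \oc f) \oc g.
    by rewrite !compmA fg compm1l -compmA fg compm1r.
  by apply: is_iso_comp; [apply: is_iso_comp; [exists g | exists z] | exists f].
move=> x y; rewrite !tr => nx ny; rewrite compmD compDm; exact: addX.
Qed.

End Composition.

(** * Exact sequences of triangles *)

Section Triangles.
Variables (k : fieldType) (C : triCat k).
Implicit Types X Y Z M A B : C.

Lemma suspm0 X Y : suspm (0 : mor X Y) = 0.
Proof. by have [] := linear_morph (suspm_linear (X := X) (Y := Y)). Qed.
Lemma suspmD X Y : {morph (@suspm _ C X Y) : f g / f + g}.
Proof. by have [] := linear_morph (suspm_linear (X := X) (Y := Y)). Qed.
Lemma suspmN X Y : {morph (@suspm _ C X Y) : f / - f}.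
Proof. by have [] := linear_morph (suspm_linear (X := X) (Y := Y)). Qed.
Lemma suspmZ X Y a : {morph (@suspm _ C X Y) : f / a *: f}.
Proof. by have [] := linear_morph (suspm_linear (X := X) (Y := Y)). Qed.

Lemma suspm_inj X Y : injective (@suspm _ C X Y).
Proof. exact: bij_inj (suspm_bij _ _). Qed.

Lemma suspm_surj X Y (g : mor (susp X) (susp Y)) : exists f, g = suspm f.
Proof. by have [h _ hK] := suspm_bij X Y; exists (h g); rewrite hK. Qed.

Lemma suspm_eq0 X Y (f : mor X Y) : suspm f = 0 -> f = 0.
Proof. by move=> f0; apply: suspm_inj; rewrite f0 suspm0. Qed.

Lemma susp_zero X : is_zero X -> is_zero (susp X).
Proof. by rewrite /is_zero -suspm1 => ->; rewrite suspm0. Qed.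

Section Exact.
Variables (X Y Z : C) (u : mor X Y) (v : mor Y Z) (w : mor Z (susp X)).
Hypothesis T : dtri u v w.

Lemma dtri_comp0 : v \oc u = 0.
Proof.
have [O O0] := zero_ex C.
have e : u \oc idm X = u \oc idm X by [].
by have [c [<- _]] := dtri_mor (dtri_id X O0) T e; rewrite compm0.
Qed.

(** TR3 extends [f] to a morphism from the rotated trivial triangle on [A] to the rotation of [T];
    its third component desuspends to [g]. *)
Lemma dtri_liftl A (f : mor A Y) : v \oc f = 0 -> exists g, f = u \oc g.
Proof.
move=> vf; have [O O0] := zero_ex C.
have e : (0 : mor O Z) \oc (0 : mor A O) = v \oc f by rewrite vf compm0.
have [c [_]] := dtri_mor ((dtri_rot _ _ _).1 (dtri_id A O0)) ((dtri_rot _ _ _).1 T) e.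
have [g ->] := suspm_surj c.
rewrite compNm compmN -!suspmM compm1r => /oppr_inj/suspm_inj->; by exists g.
Qed.

Lemma dtri_liftr A (f : mor Y A) : f \oc u = 0 -> exists g, f = g \oc v.
Proof.
move=> fu; have [O O0] := zero_ex C.
have T0 : dtri (0 : mor O A) (idm A) (0 : mor A (susp O)).
  by apply/dtri_rot; rewrite suspm0 oppr0; apply/dtri_id/susp_zero.
have e : f \oc u = (0 : mor O A) \oc (0 : mor X O) by rewrite fu compm0.
by have [c [+ _]] := dtri_mor T T0 e; rewrite compm1l => <-; exists c.
Qed.

End Exact.

Section LongExact.
Variables (X Y Z : C) (u : mor X Y) (v : mor Y Z) (w : mor Z (susp X)).
Hypothesis T : dtri u v w.

Let T1 := (dtri_rot _ _ _).1 T.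
Let T2 := (dtri_rot _ _ _).1 T1.

Lemma dtri_comp0r : w \oc v = 0. Proof. exact: dtri_comp0 T1. Qed.

Lemma dtri_comp0s : suspm u \oc w = 0.
Proof. by apply: oppr_inj; rewrite -compNm (dtri_comp0 T2) oppr0. Qed.

(** The [liftl] and [liftr] lemmas are exactness of the covariant and contravariant Hom sequences;
    the digit counts the rotations of the triangle. *)
Lemma dtri_liftl1 A (f : mor A Z) : w \oc f = 0 -> exists g, f = v \oc g.
Proof. exact: dtri_liftl T1 _ _. Qed.

Lemma dtri_liftl2 A (f : mor A (susp X)) :
  suspm u \oc f = 0 -> exists g, f = w \oc g.
Proof. by move=> uf; apply: (dtri_liftl T2); rewrite compNm uf oppr0. Qed.

Lemma dtri_liftr1 A (f : mor Z A) : f \oc v = 0 -> exists g, f = g \oc w.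
Proof. exact: dtri_liftr T1 _ _. Qed.

Lemma dtri_liftr2 A (f : mor (susp X) A) :
  f \oc w = 0 -> exists g, f = g \oc suspm u.
Proof.
by move=> /(dtri_liftr T2)[g ->]; exists (- g); rewrite compNm compmN.
Qed.

(** The obstruction to extending [f] along [u] lies in Ext(Z, A), so it disappears whenever that
    space is zero. *)
Lemma dtri_extend A (f : mor X A) :
  suspm f \oc w = 0 -> exists g, f = g \oc u.
Proof.
move=> /dtri_liftr2[g]; have [h ->] := suspm_surj g.
by rewrite -suspmM => /suspm_inj->; exists h.
Qed.

Lemma dtri_liftl3 A (f : mor A (susp Y)) :
  suspm v \oc f = 0 -> exists g, f = suspm u \oc g.
Proof.
move=> vf; have [|g ->] := dtri_liftl ((dtri_rot _ _ _).1 T2) (f := f).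
  by rewrite compNm vf oppr0.
by exists (- g); rewrite compNm compmN.
Qed.

(** Since [w] vanishes, [v] has a section [s] and [u] is monic; [idm Y - s \oc v] is killed by [v],
    and its factor through [u] is the other projection. *)
Lemma dtri_split : w = 0 -> is_biprod X Z Y.
Proof.
move=> w0; have [|s /esym vs] := @dtri_liftl1 Z (idm Z); first by rewrite compm1r.
have [|p e] := @dtri_liftl _ _ _ _ _ _ T Y (idm Y - s \oc v).
  by rewrite compmB compm1r compmA vs compm1l subrr.
have monou A (f : mor A X) : u \oc f = 0 -> f = 0.
  move=> uf; apply: suspm_eq0; have [|g ->] := @dtri_liftl2 _ (suspm f).
    by rewrite -suspmM uf suspm0.
  by rewrite w0 comp0m.
have vu := dtri_comp0 T.
have pu : p \oc u = idm X.
  apply/eqP; rewrite -subr_eq0; apply/eqP/monou.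
  by rewrite compmB compmA -e compBm -compmA vu compm0 compm1l compm1r subr0 subrr.
have ps : p \oc s = 0.
  by apply: monou; rewrite compmA -e compBm -compmA vs compm1l compm1r subrr.
by constructor; apply: (Biprod pu vs ps vu); rewrite -e subrK.
Qed.

End LongExact.

(** The connecting map of the cone of a section [f] is killed by the split monomorphism [suspm f],
    so the triangle splits. *)
Lemma retract_biprod X Y : retract X Y -> exists Z, is_biprod X Z Y.
Proof.
case=> f [g gf]; have [Z [v [w T]]] := dtri_cone f; exists Z; apply: (dtri_split T).
by rewrite -[w]compm1l -suspm1 -gf suspmM -compmA (dtri_comp0s T) compm0.
Qed.

Lemma dtri_cocone Z X (w : mor Z (susp X)) : exists Y (u : mor X Y) (v : mor Y Z), dtri u v w.
Proof.
have [W [a [b T]]] := dtri_cone w; have [Y [t it]] := susp_esssurj W.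
have [t' [t't tt']] := it.
have [u eu] := suspm_surj (- (t' \oc a)); have [v ev] := suspm_surj (- (b \oc t)).
exists Y, u, v; apply/dtri_rot/dtri_rot; rewrite -eu -ev !opprK.
have it' : is_iso t' by exists t.
apply: dtri_iso (is_iso_id _) (is_iso_id _) it' _ _ _ T; rewrite ?compm1l ?compm1r //.
by rewrite suspm1 compm1l -compmA tt' compm1r.
Qed.

Lemma dtri_fiber Y Z (v : mor Y Z) : exists X (u : mor X Y) (w : mor Z (susp X)), dtri u v w.
Proof.
have [W [a [b T]]] := dtri_cone v; have [X [t it]] := susp_esssurj W.
have [t' [t't tt']] := it; have it' : is_iso t' by exists t.
have [u eu] := suspm_surj (- (b \oc t)); exists X, u, (t' \oc a).
apply/dtri_rot; rewrite -eu opprK.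
apply: dtri_iso (is_iso_id _) (is_iso_id _) it' _ _ _ T; rewrite ?compm1l ?compm1r //.
by rewrite suspm1 compm1l -compmA tt' compm1r.
Qed.

(** Three rotations of a triangle negate all three suspended maps; minus the identity on the middle
    object removes two of the signs. *)
Lemma dtri_desusp X Y Z (a : mor X Y) (b : mor Y Z) (c : mor Z (susp X)) :
  dtri (suspm a) (suspm b) (- suspm c) -> dtri a b c.
Proof.
move=> T; apply/dtri_rot/dtri_rot/dtri_rot.
have iN (W : C) : is_iso (- idm W).
  by exists (- idm W); rewrite compNm compmN compm1l opprK.
apply: dtri_iso (is_iso_id _) (iN _) (is_iso_id _) _ _ _ T;
  by rewrite ?suspm1 ?compNm ?compmN ?compm1l ?compm1r ?opprK.
Qed.

(* [P] is the homotopy pushout of [u] and [u']. *)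
Lemma dtri_pushout X Y Z Y' Z' (u : mor X Y) (v : mor Y Z) (w : mor Z (susp X))
    (u' : mor X Y') (v' : mor Y' Z') (w' : mor Z' (susp X)) :
  dtri u v w -> dtri u' v' w' ->
  exists P (a : mor Y' P) (b : mor P Z) (a' : mor Y P) (b' : mor P Z'),
    dtri a b (suspm u' \oc w) /\ dtri a' b' (- (suspm u \oc w')).
Proof.
move=> T T'; have [P [a [b TP]]] := dtri_cocone (suspm u' \oc w).
have iN (W : C) : is_iso (- idm W).
  by exists (- idm W); rewrite compNm compmN compm1l opprK.
have Tu := (dtri_rot _ _ _).1 ((dtri_rot _ _ _).1 T).
have Tu' : dtri (suspm u') (suspm v') (- suspm w').
  have T3 := (dtri_rot _ _ _).1 ((dtri_rot _ _ _).1 ((dtri_rot _ _ _).1 T')).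
  apply: dtri_iso (is_iso_id _) (iN _) (is_iso_id _) _ _ _ T3;
    by rewrite ?suspm1 ?compNm ?compmN ?compm1l ?compm1r ?opprK.
have TP2 := (dtri_rot _ _ _).1 ((dtri_rot _ _ _).1 TP).
(* The octahedron on [w] followed by [suspm u'] links the cones [susp Y], [susp Z'] and [susp P];
   its new triangle is the suspension of the second one sought. *)
have [f [g []]] := dtri_oct Tu Tu' TP2.
have [f0 ->] := suspm_surj f; have [g0 ->] := suspm_surj g => Tfg _.
exists P, a, b, f0, g0; split=> //; apply: dtri_desusp.
by rewrite suspmN opprK suspmM -[suspm (suspm u)]opprK -suspmN compNm -compmN.
Qed.

End Triangles.

(** * Krull-Schmidt decompositions *)

Section Families.
Variables (k : fieldType) (C : linCat k).
Implicit Types X Y Z M A B : C.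

Definition fcons X n (F : 'I_n -> C) : 'I_n.+1 -> C :=
  fun i => oapp F X (unlift ord0 i).

Lemma fcons0 X n (F : 'I_n -> C) : fcons X F ord0 = X.
Proof. by rewrite /fcons unlift_none. Qed.

Lemma fconsS X n (F : 'I_n -> C) j : fcons X F (lift ord0 j) = F j.
Proof. by rewrite /fcons liftK. Qed.

Lemma fcons_eta n (F : 'I_n.+1 -> C) : F = fcons (F ord0) (fun j => F (lift ord0 j)).
Proof.
by apply/funext => i; case: (unliftP ord0 i) => [j|] ->; rewrite ?fcons0 ?fconsS.
Qed.

Lemma dirsum_fcons X n (F : 'I_n -> C) Y Z :
  biprod X Y Z -> dirsum F Y -> dirsum (fcons X F) Z.
Proof.
move=> b d.
pose I (o : option 'I_n) : mor (oapp F X o) Z :=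
  if o is Some j then binr b \oc dinj d j else binl b.
pose P (o : option 'I_n) : mor Z (oapp F X o) :=
  if o is Some j then dprj d j \oc bprr b else bprl b.
apply: (@Dirsum _ _ _ _ _ (fun i => I (unlift ord0 i)) (fun i => P (unlift ord0 i))).
- move=> i; case: (unlift ord0 i) => [j|] /=; last exact: bprl_inl.
  by rewrite compmA -(compmA (dprj d j)) bprr_inr compm1r dprj_inj.
- move=> i j; case: (unliftP ord0 i) => [i'|] ->; case: (unliftP ord0 j) => [j'|] ->;
    rewrite ?unlift_none ?liftK ?eqxx //= => neq.
  + by rewrite compmA -(compmA (dprj d j')) bprr_inr compm1r dprj_inj0.
  + by rewrite compmA bprl_inr comp0m.
  + by rewrite -compmA bprr_inl compm0.
- rewrite big_ord_recl /= -(bin_pr b).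
  pose E o := I o \oc P o.
  rewrite -[_ \oc _]/(E (unlift ord0 ord0)) unlift_none; congr (_ + _).
  rewrite (eq_bigr (fun j => binr b \oc (dinj d j \oc dprj d j) \oc bprr b)) => [|j _].
    by rewrite -comp_suml -comp_sumr dinj_prj compm1r.
  by rewrite -[LHS]/(E (unlift ord0 (lift ord0 j))) liftK /E /= !compmA.
Qed.

(** Prepares a basic complement of [X]: the head of the family is kept only if it is isomorphic
    neither to [X] nor to a member already kept. *)
Lemma prune_family X n (H : 'I_n -> C) :
  exists m (G : 'I_m -> C), [/\ forall j, exists i, G j = H i,
    forall i j, G i ~= G j -> i = j, forall j, ~ (G j ~= X) &
    forall i, H i ~= X \/ exists j, H i ~= G j].
Proof.
elim: n H => [|n IHn] H; first by exists 0%N, H; split=> // -[].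
have [m [G [GH Ginj GX HG]]] := IHn (fun j => H (lift ord0 j)).
have {}HG i : H (lift ord0 i) ~= X \/ (exists j, H (lift ord0 i) ~= G j) by [].
have {}GH j : exists i, G j = H i by have [i ->] := GH j; exists (lift ord0 i).
have [H0|/not_orP[H0X /forallNP H0G]] :=
  pselect (H ord0 ~= X \/ exists j, H ord0 ~= G j).
  by exists m, G; split=> // i; case: (unliftP ord0 i) => [i'|] ->.
exists m.+1, (fcons (H ord0) G); split.
- by move=> j; case: (unliftP ord0 j) => [j'|] ->; rewrite ?fcons0 ?fconsS //; exists ord0.
- move=> i j; case: (unliftP ord0 i) => [i'|] ->; case: (unliftP ord0 j) => [j'|] -> //;
    rewrite ?fcons0 ?fconsS.
  + by move=> /Ginj->.
  + by move=> /iso_sym/H0G.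
  + by move=> /H0G.
- by move=> j; case: (unliftP ord0 j) => [j'|] ->; rewrite ?fcons0 ?fconsS.
- move=> i; case: (unliftP ord0 i) => [i'|] ->.
    have [] := HG i'; first by left.
    by case=> j Hj; right; exists (lift ord0 j); rewrite fconsS.
  by right; exists ord0; rewrite fcons0; apply: iso_refl.
Qed.

End Families.

Section KrullSchmidt.
Variables (k : fieldType) (C : triCat k).
Implicit Types X Y Z M A B L N : C.

Lemma dirsum_ex n (F : 'I_n -> C) : exists Z, is_dirsum F Z.
Proof.
elim: n F => [|n IHn] F.
  have [O O0] := zero_ex C; exists O; constructor.
  have E T (i : 'I_0) : T by case: i.
  pose i0 i := E (mor (F i) O) i; pose p0 i := E (mor O (F i)) i.
  by apply: (@Dirsum _ _ _ _ _ i0 p0) => [[]|[]|] //; rewrite big_ord0 O0.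
have [Y [d]] := IHn (fun j => F (lift ord0 j)).
have [Z [b]] := biprod_ex (F ord0) Y; exists Z; constructor.
by rewrite (fcons_eta F); exact: dirsum_fcons b d.
Qed.

(** For the converse, the identity is a sum of finitely many composites through [M]; these assemble
    into a section and a retraction through a power of [M], and retracts have complements. *)
Lemma in_addP M X : in_add M X <-> inadd M X.
Proof.
split=> [[n [Y [Z [[d] [b]]]]]|MX].
  apply: (inadd_trans (Y := Y)); last exact: inadd_retract (biprod_retractl b).
  by apply: (inadd_dirsum d (M := M)) => _; exact: inadd_refl.
pose e (b : mor X M * mor M X) := b.2 \oc b.1.
have [s es] : exists s : seq (mor X M * mor M X), idm X = \sum_(b <- s) e b.
  move: MX; rewrite /inadd; move: (idm X); apply: thru_ind => [|a u v [s ->] [t ->]|g f].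
  - by exists [::]; rewrite big_nil.
  - exists ([seq (b.1, a *: b.2) | b <- s] ++ t); rewrite big_cat big_map /=.
    congr (_ + _); rewrite scaler_sumr; apply: eq_bigr => b _.
    by rewrite /e compZm.
  - by exists [:: (f, g)]; rewrite big_seq1.
have [Y [d]] := dirsum_ex (fun _ : 'I_(size s) => M).
suff /retract_biprod[Z XZY] : retract X Y by exists (size s), Y, Z; split.
exists (\sum_(i < size s) dinj d i \oc (nth (0, 0) s i).1),
  (\sum_(i < size s) (nth (0, 0) s i).2 \oc dprj d i).
rewrite es (big_nth (0, 0)) big_mkord comp_suml; apply: eq_bigr => i _.
rewrite -compmA comp_sumr (bigD1 i) //= big1 => [|j ji].
  by rewrite addr0 (compmA (dprj d i)) dprj_inj compm1l.
by rewrite (compmA (dprj d i)) dprj_inj0 // comp0m.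
Qed.

(** Take one copy of [M] for each element of a basis of Hom(M, X), with the basis as components of
    [w]. *)
Lemma right_approx M X :
  exists A (w : mor A X), inadd M A /\ forall g : mor M X, exists g', g = w \oc g'.
Proof.
pose b := vbasis (fullv : {vspace mor M X}).
have [A [d]] := dirsum_ex (fun _ : 'I_(\dim (fullv : {vspace mor M X})) => M).
exists A, (\sum_(i < \dim (fullv : {vspace mor M X})) b`_i \oc dprj d i); split.
  by apply: (inadd_dirsum d (M := M)) => _; exact: inadd_refl.
move=> g; exists (\sum_i coord b i g *: dinj d i).
rewrite [LHS](coord_vbasis (memvf g)) comp_sumr; apply: eq_bigr => i _.
rewrite compmZ comp_suml (bigD1 i) //= big1 => [|j ji].
  by rewrite addr0 -compmA dprj_inj compm1r.
by rewrite -compmA dprj_inj0 ?compm0 // eq_sym.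
Qed.

Hypothesis ksC : krull_schmidt C.

(** A nonzero object has some local Krull-Schmidt summand; by indecomposability its complement is
    zero. *)
Lemma indecomposable_local X : indecomposable X -> local_end X.
Proof.
case=> X0 indX; have [n [F [[d] locF]]] := ksC X.
have [i] : exists i : 'I_n, True.
  case: n F d {locF} => [|n] F d; last by exists ord0.
  by case: X0; rewrite /is_zero -(dinj_prj d) big_ord0.
have [Z ZX] := retract_biprod (dirsum_retract d i) => _.
have [Fi0|Z0] := indX _ _ ZX; first by case: (locF i).
apply: local_iso (locF i); case: ZX => b; exists (binl b), (bprl b).
rewrite bprl_inl; split=> //; rewrite -(bin_pr b) [binr b \oc _](_ : _ = 0) ?addr0 //.
by rewrite -[binr b]compm1r Z0 compm0 comp0m.
Qed.

Lemma inadd_local M X :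
  (forall H, local_end H -> retract H X -> inadd M H) -> inadd M X.
Proof.
move=> MH; have [n [F [[d] locF]]] := ksC X.
by apply: (inadd_dirsum d) => i; apply: MH => //; exact: dirsum_retract d i.
Qed.

(** A local summand of [X] is a retract of [A] or of [B]; in the first case it is isomorphic to [A],
    making [A] a retract of [X]. *)
Lemma inadd_biprod_drop A B Z X : biprod A B Z -> local_end A ->
  inadd Z X -> ~ retract A X -> inadd B X.
Proof.
move=> b locA ZX nAX; apply: inadd_local => H locH HX.
have /(local_inadd locH) HZ : inadd Z H := inadd_trans ZX (inadd_retract HX).
have [HA|HB] := local_biprod locH b HZ; last exact: inadd_retract.
by case: nAX; apply: retract_trans HX; case: (iso_retract (local_retract_iso locH locA HA)).
Qed.

End KrullSchmidt.

(** * Completion of rigid objects *)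

Section Ext.
Variables (k : fieldType) (C : triCat k).
Implicit Types X Y Z M A B L N T R U : C.

(** Vanishing of Ext(X, Y); [rigid M] is convertible to [ext0 M M]. *)
Definition ext0 X Y := forall f : mor X (susp Y), f = 0.

Lemma thru_ext0r M X Y Z (x : mor Y Z) (f : mor X (susp Y)) :
  x \in thru M Y Z -> ext0 X M -> suspm x \oc f = 0.
Proof.
move=> + XM; move: x; apply: thru_ind => [|a u v Hu Hv|g h].
- by rewrite suspm0 comp0m.
- by rewrite suspmD suspmZ compDm compZm Hu Hv scaler0 add0r.
- by rewrite suspmM -compmA [suspm h \oc f]XM compm0.
Qed.

Lemma thru_ext0l M X Y Z (x : mor X Y) (f : mor Y (susp Z)) :
  x \in thru M X Y -> ext0 M Z -> f \oc x = 0.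
Proof.
move=> + MZ; move: x; apply: thru_ind => [|a u v Hu Hv|g h].
- by rewrite compm0.
- by rewrite compmD compmZ Hu Hv scaler0 add0r.
- by rewrite compmA [f \oc g]MZ comp0m.
Qed.

Lemma ext0_inaddr M X Y : inadd M Y -> ext0 X M -> ext0 X Y.
Proof. by move=> MY XM f; rewrite -[f]compm1l -suspm1; apply: thru_ext0r MY XM. Qed.

Lemma ext0_inaddl M X Y : inadd M X -> ext0 M Y -> ext0 X Y.
Proof. by move=> MX MY f; rewrite -[f]compm1r; apply: thru_ext0l MX MY. Qed.

Lemma ext0_biprodr A B Z X : biprod A B Z -> ext0 X A -> ext0 X B -> ext0 X Z.
Proof.
move=> b XA XB f; rewrite -[f]compm1l -suspm1 -(bin_pr b) suspmD !suspmM compDm.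
by rewrite -!compmA [_ \oc f]XA [_ \oc f]XB !compm0 addr0.
Qed.

Lemma ext0_biprodl A B Z X : biprod A B Z -> ext0 A X -> ext0 B X -> ext0 Z X.
Proof.
move=> b AX BX f; rewrite -[f]compm1r -(bin_pr b) compmD !compmA.
by rewrite [f \oc _]AX [f \oc binr _]BX !comp0m addr0.
Qed.

Lemma ext0_dtrir X Y Z A (u : mor X Y) (v : mor Y Z) w :
  dtri u v w -> ext0 A X -> ext0 A Z -> ext0 A Y.
Proof.
move=> T AX AZ f; have [|g ->] := dtri_liftl3 T (f := f); first exact: AZ.
by rewrite [g]AX compm0.
Qed.

Lemma ext0_dtril X Y Z A (u : mor X Y) (v : mor Y Z) w :
  dtri u v w -> ext0 X A -> ext0 Z A -> ext0 Y A.
Proof.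
move=> T XA ZA f; have [|g ->] := dtri_liftr T (f := f); first exact: XA.
by rewrite [g]ZA comp0m.
Qed.

(** As in Wakamatsu's lemma: a map from [M] to [susp Y] comes from [susp X], hence factors through
    [w], and [suspm u] kills [w]. *)
Lemma ext0_approx M X A Y (w : mor A (susp X)) (u : mor X Y) (v : mor Y A) :
  dtri u v w -> (forall g : mor M (susp X), exists g', g = w \oc g') ->
  ext0 M A -> ext0 M Y.
Proof.
move=> T appr MA f; have [|g ->] := dtri_liftl3 T (f := f); first exact: MA.
by have [g' ->] := appr g; rewrite compmA (dtri_comp0s T) comp0m.
Qed.

Lemma cluster_tilting_inadd T T' :
  inadd T T' -> inadd T' T -> cluster_tilting T -> cluster_tilting T'.
Proof.
move=> TT' T'T [rigT ctT]; split.
  by apply: (ext0_inaddr TT'); apply: (ext0_inaddl TT').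
move=> Y T'Y; apply/in_addP; apply: (inadd_trans T'T).
by apply/in_addP/ctT/(ext0_inaddl T'T).
Qed.

Hypothesis cyC : two_calabi_yau C.

(** Calabi-Yau duality pairs Ext(Y, X) with Hom(susp X, susp (susp Y)), which is Ext(X, Y)
    suspended. *)
Lemma ext0_sym X Y : ext0 X Y -> ext0 Y X.
Proof.
have [phi [phi_lin phi_bij _]] := cyC.
move=> XY f; apply: (bij_inj (phi_bij _ _)); apply/lfunP => t.
have [s ->] := suspm_surj t.
by rewrite [s]XY suspm0 !linear0.
Qed.

Lemma dim_ext_sym X Y : \dim {: mor X (susp Y)} = \dim {: mor Y (susp X)}.
Proof.
have [phi [phi_lin phi_bij _]] := cyC.
rewrite (dim_bij (phi_lin X (susp Y)) (phi_bij _ _)).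
rewrite [RHS](dim_bij (suspm_linear (X := Y) (Y := susp X)) (suspm_bij _ _)).
by rewrite !dimvf /dim /= muln1.
Qed.

(* [U] is the cocone of a right [add R]-approximation of [susp T]. *)
Lemma rigid_completion T R : cluster_tilting T -> rigid R ->
  exists T', cluster_tilting T' /\ retract R T'.
Proof.
move=> [rigT ctT] rigR.
have approx A : exists B S (u : mor A B) (v : mor B S) (w : mor S (susp A)),
    [/\ dtri u v w, inadd R S & ext0 R B].
  have [S [w [RS appr]]] := right_approx R (susp A).
  have [B [u [v TB]]] := dtri_cocone w; exists B, S, u, v, w; split=> //.
  by apply: ext0_approx TB appr _; exact: ext0_inaddr RS rigR.
have [U [R' [u [v [w [TU RR' RU]]]]]] := approx T.
have [T' [b]] := biprod_ex U R.
have UR := ext0_sym RU.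
have UR' : ext0 U R' := ext0_inaddr RR' UR.
(* A self-extension of [U] lifts to [susp T], vanishes on [T] by rigidity, hence factors through
   [R'] in add R, and Ext(R, U) is zero. *)
have rigU : rigid U.
  move=> f; have [|g ->] := dtri_liftl3 TU (f := f); first exact: UR'.
  have [|g' ->] := dtri_liftr TU (f := g); first exact: rigT.
  by rewrite compmA; apply: (thru_ext0l (M := R)) => //; rewrite -[v]compm1l; exact: thru_compr.
have rigT' : rigid T' by apply: (ext0_biprodl b); apply: (ext0_biprodr b).
have T'U : inadd T' U := inadd_retract (biprod_retractl b).
have T'R : inadd T' R := inadd_retract (biprod_retractr b).
(* Factorizations of [idm A] through [T] lift to maps between [B] and [U]. *)
have inT' A B S (j : mor A B) (e : mor B S) (c : mor S (susp A)) :
    dtri j e c -> inadd T A -> inadd R S -> ext0 R B -> inadd T' B.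
  move=> TB TA RS RB.
  have factor : forall x, x \in thru T A A -> exists2 y, y \in thru T' B B & j \oc x = y \oc j.
    apply: thru_ind => [|a x x' [y yP e1] [y' y'P e2]|f g].
    - by exists 0; rewrite ?mem0v // compm0 comp0m.
    - exists (a *: y + y'); first by rewrite rpredD ?rpredZ.
      by rewrite compmD compmZ compDm compZm e1 e2.
    - have [|g' eg] := dtri_extend TB (f := u \oc g).
        by apply: (ext0_inaddl RS).
      have [|f' ef] := dtri_extend TU (f := j \oc f).
        by apply: (ext0_inaddl RR').
      exists (f' \oc g'); first by apply: (inadd_thru T'U); exact: mem_thru.
      by rewrite compmA ef -compmA eg compmA.
  have [y yP ey] := factor _ TA.
  (* Since [y] fixes [j], the difference [idm B - y] factors through [S], which lies in add R. *)
  have [|z ez] := dtri_liftr TB (f := idm B - y).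
    by rewrite compBm -ey compm1l compm1r subrr.
  rewrite /inadd -(subrK y (idm B)) ez rpredD //.
  by apply: (inadd_thru (inadd_trans T'R RS)); exact: mem_thru.
exists T'; split; last exact: biprod_retractr b.
split=> // Y T'Y; apply/in_addP.
have YT' := ext0_sym T'Y.
have RY : ext0 R Y by apply: (ext0_inaddl T'R).
have [T0 [p [TT0 appr]]] := right_approx T Y.
have [T1 [j [y TY]]] := dtri_fiber p.
(* The fiber of a right add T-approximation has no extensions from [T], so [T1], [T0] form an add
   T-presentation of [Y]. *)
have TT1 : inadd T T1.
  apply/in_addP/ctT => f.
  have [|g ->] := dtri_liftl2 TY (f := f); first exact: (ext0_inaddr TT0 rigT).
  by have [g' ->] := appr g; rewrite compmA (dtri_comp0r TY) comp0m.
have [U1 [S1 [u1 [v1 [w1 [TU1 RS1 RU1]]]]]] := approx T1.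
(* Pushing the presentation out along [u1] gives a triangle on [T0], [P], [S1], which puts [P] in
   add T', and one on [U1], [P], [Y], which splits because Ext(Y, U1) is zero. *)
have [P [a [b1 [a' [b' [TP TP']]]]]] := dtri_pushout TY TU1.
have T'U1 : inadd T' U1 := inT' _ _ _ _ _ _ TU1 TT1 RS1 RU1.
have RP : ext0 R P := ext0_dtrir TP RU1 RY.
have T'P : inadd T' P := inT' _ _ _ _ _ _ TP' TT0 RS1 RP.
have [bP] := dtri_split TP (ext0_inaddr T'U1 YT' _).
exact: inadd_trans T'P (inadd_retract (biprod_retractr bP)).
Qed.

End Ext.

(** * Exchange pairs from one-dimensional extension spaces *)

Section Exchange.
Variables (k : fieldType) (C : triCat k).
Implicit Types X Y Z M A B L N T R U : C.

(** On a line [r] acts by a scalar [a]. If [a] were nonzero, [r - a *: idm L] would be a unit in the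
    local ring, yet it kills [h]. *)
Lemma nonunit_annihilates L N (r : mor L L) (h : mor N (susp L)) :
  local_end L -> \dim {: mor N (susp L)} = 1%N -> ~ is_iso r -> suspm r \oc h = 0.
Proof.
move=> locL dim1 nr; have [->|h0] := eqVneq h 0; first by rewrite compm0.
have [a ea] : exists a, suspm r \oc h = a *: h.
  apply/vlineP; suff -> : <[h]>%VS = fullv by rewrite memvf.
  by apply/eqP; rewrite eqEdim subvf dim_vline h0 dim1.
have [a0|a0] := eqVneq a 0; first by rewrite ea a0 scale0r.
have [J JP] := local_nonunits locL.
have [s [sr _]] : is_iso (r - a *: idm L).
  apply: contrapT => /JP rJ; have /JP[] : a *: idm L \in J.
    rewrite -[X in X \in _](subKr r); apply: rpredB => //; exact/JP.
  exact/is_isoZ/is_iso_id.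
have : suspm (r - a *: idm L) \oc h = 0.
  by rewrite suspmD suspmN suspmZ suspm1 compBm compZm compm1l ea subrr.
move=> /(congr1 (fun x => suspm s \oc x)); rewrite compmA -suspmM sr suspm1 compm1l compm0.
by move=> /eqP; rewrite (negPf h0).
Qed.

Hypothesis cyC : two_calabi_yau C.

(* A nonzero [x] factors as [h \oc f]; duality gives [s = suspm q \oc h'] pairing
   nontrivially with it, so [suspm (f \oc q) \oc h'] is nonzero and [f \oc q] is
   invertible. *)
Lemma ext0_of_exchange_triangles L N E E' X (u : mor N E) (v : mor E L)
    (h : mor L (susp N)) (u' : mor L E') (v' : mor E' N) (h' : mor N (susp L)) :
  dtri u v h -> dtri u' v' h' ->
  local_end L -> \dim {: mor N (susp L)} = 1%N ->
  ext0 X E -> ext0 E' X -> ~ retract L X -> ext0 X N.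
Proof.
have [phi [phi_lin phi_bij phi_nat]] := cyC.
move=> T T' locL dim1 XE EX nLX x.
have [|f ->] := dtri_liftl2 T (f := x); first exact: XE.
apply: (bij_inj (phi_bij _ _)); have [-> _ _ _ _] := linear_morph (phi_lin X (susp N)).
apply/lfunP => t; rewrite lfunE /= -[h \oc f]compm1l compmA phi_nat compm1r.
have [s ->] := suspm_surj t.
have [|q0 ->] := dtri_liftr1 T' (f := s); first exact: EX.
have [q ->] := suspm_surj q0.
rewrite -suspmM compmA -suspmM nonunit_annihilates ?suspm0 ?linear0 //.
case=> g [gfq _]; apply: nLX; exists q, (g \oc f).
by rewrite -compmA.
Qed.

Hypothesis ksC : krull_schmidt C.

Lemma basic_fcons L Tb T n (G : 'I_n -> C) : biprod L Tb T -> dirsum G Tb ->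
  local_end L -> (forall j, local_end (G j)) ->
  (forall i j, G i ~= G j -> i = j) -> (forall j, ~ (G j ~= L)) -> basic T.
Proof.
move=> b d locL locG Ginj GL; exists n.+1, (fcons L G); split.
  by constructor; exact: dirsum_fcons b d.
split=> [i|i j].
  by apply: local_indecomposable; case: (unliftP ord0 i) => [j|] ->; rewrite ?fcons0 ?fconsS.
case: (unliftP ord0 i) => [i'|] ->; case: (unliftP ord0 j) => [j'|] -> //;
  rewrite ?fcons0 ?fconsS.
- by move=> /Ginj->.
- by move=> /GL.
- by move=> /iso_sym/GL.
Qed.

Lemma exchange_pair_of_dim1 L N : (exists T, cluster_tilting T) ->
  indecomposable L -> rigid L -> indecomposable N -> rigid N ->
  \dim {: mor L (susp N)} = 1%N -> exchange_pair L N.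
Proof.
move=> [T0 ctT0] indL rigL indN rigN dimLN.
have dimNL := etrans (dim_ext_sym cyC N L) dimLN.
have [locL locN] := (indecomposable_local ksC indL, indecomposable_local ksC indN).
have nLN : ~ ext0 L N.
  move=> LN; move: dimLN; rewrite (_ : fullv = 0%VS) ?dimv0 //.
  by apply/eqP; rewrite -subv0; apply/subvP => f _; rewrite memv0 [f]LN.
have nNL : ~ ext0 N L by move=> /(ext0_sym cyC).
(* Every map from [A] to [susp B] is a multiple of [h], and both [suspm u \oc h] and [h \oc v]
   vanish. *)
have middle A B : rigid A -> rigid B -> \dim {: mor A (susp B)} = 1%N ->
    exists E (u : mor B E) (v : mor E A) (h : mor A (susp B)),
      [/\ dtri u v h, ext0 A E & ext0 E B].
  move=> rigA rigB dimAB.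
  have [h h0] : exists h : mor A (susp B), h != 0.
    exists (vpick fullv); rewrite vpick0 -dimv_eq0 dimAB; done.
  have mult (x : mor A (susp B)) : exists a, x = a *: h.
    apply/vlineP; suff -> : <[h]>%VS = fullv by rewrite memvf.
    by apply/eqP; rewrite eqEdim subvf dim_vline h0 dimAB.
  have [E [u [v T]]] := dtri_cocone h; exists E, u, v, h; split=> // f.
    have [|g ->] := dtri_liftl3 T (f := f); first exact: rigA.
    have [a ->] := mult g.
    by rewrite compmZ (dtri_comp0s T) scaler0.
  have [|g ->] := dtri_liftr T (f := f); first exact: rigB.
  have [a ->] := mult g.
  by rewrite compZm (dtri_comp0r T) scaler0.
have [E [u [v [h [TE LE EN]]]]] := middle _ _ rigL rigN dimLN.
have [E' [u' [v' [h' [TE' NE' E'L]]]]] := middle _ _ rigN rigL dimNL.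
have EL := ext0_sym cyC LE; have LE' := ext0_sym cyC E'L.
have EE : ext0 E E := ext0_dtrir TE EN EL.
have EE' : ext0 E E' := ext0_dtrir TE' EL EN.
have E'E := ext0_sym cyC EE'.
have E'N := ext0_sym cyC NE'.
have E'E' : ext0 E' E' := ext0_dtrir TE' E'L E'N.
have [S [bS]] := biprod_ex E E'; have [R [bR]] := biprod_ex L S.
have rigR : rigid R.
  by apply: (ext0_biprodl bR); apply: (ext0_biprodr bR) => //;
    do ?[apply: (ext0_biprodl bS) | apply: (ext0_biprodr bS)].
have [T' [ctT' RT']] := rigid_completion cyC ctT0 rigR.
have LT' := retract_trans (biprod_retractl bR) RT'.
(* Repeated summands and copies of [L] are removed from [T']; adding [L] back once gives a basic [T]
   with the same additive closure. *)
have [n [H [[dH] locH]]] := ksC T'.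
have [m [G [GH Ginj GL HG]]] := prune_family L H.
have [Tb [d]] := dirsum_ex G; have [T [b]] := biprod_ex L Tb.
have locG j : local_end (G j) by have [i ->] := GH j.
have T'T : inadd T' T.
  apply: (inadd_biprod b); first exact: inadd_retract.
  apply: (inadd_dirsum d) => j; have [i ->] := GH j; exact/inadd_retract/(dirsum_retract dH).
have TT' : inadd T T'.
  apply: (inadd_dirsum dH) => i; apply: inadd_retract.
  have [/iso_retract[HiL _]|[j /iso_retract[HiG _]]] := HG i.
    exact: retract_trans HiL (biprod_retractl b).
  exact: retract_trans HiG (retract_trans (dirsum_retract d j) (biprod_retractr b)).
have ctT := cluster_tilting_inadd T'T TT' ctT'; have [rigT _] := ctT.
have TL := inadd_retract (biprod_retractl b); have TTb := inadd_retract (biprod_retractr b).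
have rigTb : rigid Tb by apply: (ext0_inaddr TTb); apply: (ext0_inaddl TTb).
have TbL : ext0 Tb L by apply: (ext0_inaddr TL); apply: (ext0_inaddl TTb).
have nLTb : ~ retract L Tb.
  move=> /(local_dirsum locL d)[j /(local_retract_iso locL (locG j))]/iso_sym; exact: GL.
have TR : inadd T R by apply: inadd_trans TT' (inadd_retract RT').
have TS := inadd_trans TR (inadd_retract (biprod_retractr bR)).
have nrL X : ext0 X N -> ~ retract L X.
  by move=> XN /inadd_retract LX; apply/nLN/(ext0_inaddl LX).
(* [L] is not a summand of [E] or [E'], as these have no extensions by [N] while Ext(L, N) is
   nonzero. *)
have TbE : inadd Tb E.
  apply: (inadd_biprod_drop ksC b locL _ (nrL _ EN)).
  exact: inadd_trans TS (inadd_retract (biprod_retractl bS)).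
have TbE' : inadd Tb E'.
  apply: (inadd_biprod_drop ksC b locL _ (nrL _ E'N)).
  exact: inadd_trans TS (inadd_retract (biprod_retractr bS)).
have TbN : ext0 Tb N.
  apply: (ext0_of_exchange_triangles TE TE') => //.
    exact: (ext0_inaddr TbE).
  exact: (ext0_inaddl TbE').
have [T2 [b2]] := biprod_ex N Tb.
have T2N := inadd_retract (biprod_retractl b2).
have T2Tb := inadd_retract (biprod_retractr b2).
have NTb := ext0_sym cyC TbN.
have rigT2 : rigid T2.
  by apply: (ext0_biprodl b2); apply: (ext0_biprodr b2).
have GN j : ~ (G j ~= N).
  move=> /iso_retract[_ /inadd_retract NG]; apply: nNL.
  apply: (ext0_inaddl NG); apply: (ext0_inaddl _ TbL).
  exact/inadd_retract/(dirsum_retract d).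
have ctT2 : cluster_tilting T2.
  (* It suffices to treat a local summand [X] of [Y]. Unless [X] is [N], the exchange lemma with [L]
     and [N] swapped gives Ext(X, L) = 0, so [X] is in add T; it avoids [L] because Ext(X, N) =
     0. *)
  split=> // Y T2Y; apply/in_addP/(inadd_local ksC) => X locX /inadd_retract XY.
  have T2X := ext0_inaddr XY T2Y.
  have NX : ext0 N X := ext0_inaddl T2N T2X.
  have TbX : ext0 Tb X := ext0_inaddl T2Tb T2X.
  have [NrX|nNX] := pselect (retract N X).
    apply: inadd_trans T2N (inadd_retract _).
    by case: (iso_retract (local_retract_iso locN locX NrX)).
  have XL : ext0 X L.
    apply: (ext0_of_exchange_triangles TE' TE locN dimLN _ _ nNX).
      by apply/(ext0_sym cyC)/(ext0_inaddl TbE').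
    exact: (ext0_inaddl TbE).
  have TX : inadd T X.
    apply/in_addP; case: ctT => _; apply; apply: (ext0_biprodl b) => //.
    exact: ext0_sym.
  apply: (inadd_trans T2Tb); apply: (inadd_biprod_drop ksC b locL TX).
  by apply/nrL/ext0_sym.
exists Tb, T, T2; split=> //.
- by split=> //; exact: basic_fcons b d locL locG Ginj GL.
- by split=> //; exact: basic_fcons b2 d locN locG Ginj GN.
- by move=> /iso_retract[/inadd_retract LN _]; apply/nLN/(ext0_inaddl LN).
Qed.

End Exchange.

(** * Radicals and loops *)

Section Radical.
Variables (k : fieldType) (C : linCat k).
Implicit Types X Y Z M T : C.

Lemma compvS X Y Z (U U' : {vspace mor Y Z}) (V V' : {vspace mor X Y}) :
  (U <= U')%VS -> (V <= V')%VS -> (compv U V <= compv U' V')%VS.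
Proof.
move=> /subvP sU /subvP sV; apply/subvP; apply: compv_ind => [|a u v Hu Hv|g f gU fV].
- exact: mem0v.
- by rewrite rpredD ?rpredZ.
- by apply: mem_compv; [exact: sU | exact: sV].
Qed.

Lemma compv_linel X (f x : mor X X) :
  x \in compv fullv <[f]> -> exists y, x = y \oc f.
Proof.
move: x; apply: compv_ind => [|a u v [y ->] [z ->]|g _ _ /vlineP[a ->]].
- by exists 0; rewrite comp0m.
- by exists (a *: y + z); rewrite compDm compZm.
- by exists (a *: g); rewrite compmZ compZm.
Qed.

Lemma left_ideal_add_line T (I : {vspace mor T T}) (x : mor T T) :
  left_ideal I -> left_ideal (I + compv fullv <[x]>)%VS.
Proof.
move=> lI f g /memv_addP[u uI [_ /compv_linel[y ->] ->]].
rewrite compmD; apply: memv_add; first exact: lI.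
by rewrite compmA; apply: mem_compv; rewrite ?memvf ?memv_line.
Qed.

Section Retract.
Variables (X T : C) (a : mor X T) (b : mor T X).
Hypotheses (locX : local_end X) (ba : b \oc a = idm X).

(** The maps [x] for which [p \oc x \oc a] is a nonunit for all [p] form a maximal left ideal, which
    therefore contains [f]. *)
Lemma jacobson_nonunit f : f \in jacobson T -> ~ is_iso (b \oc f \oc a).
Proof.
have [J JP] := local_nonunits locX.
have [||M MP] := @vspace_of_closed _ (mor T T) (fun x => forall p, p \oc x \oc a \in J).
- by move=> p; rewrite compm0 comp0m mem0v.
- by move=> c u v Hu Hv p; rewrite compmD compmZ compDm compZm rpredD ?rpredZ.
move=> /mem_jacobson fJ; apply/JP; apply: (MP f).1; apply: fJ; split.
- by move=> g x /MP xM; apply/MP => p; rewrite compmA.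
- move=> MT; have /MP/(_ b) : idm T \in M by rewrite MT memvf.
  by rewrite compm1r ba => /JP; case; exact: is_iso_id.
move=> I lI sMI; have [/subvP sIM|/subvPn[x xI xM]] := boolP (I <= M)%VS.
  by left; apply/eqP; rewrite eqEsubv sMI andbT; apply/subvP.
(* With [s] inverse to [p \oc x \oc a], the difference [idm T - a \oc s \oc p \oc x] vanishes after
   composing with [a], so it lies in [M] and [I] contains the identity. *)
right; have [p [s [spa _]]] : exists p : mor T X, is_iso (p \oc x \oc a).
  apply: contrapT => np; case/negP: xM; apply/MP => p; apply/JP => up.
  by apply: np; exists p.
have yI : (a \oc s \oc p) \oc x \in I by exact: lI.
apply/eqP; rewrite eqEsubv subvf /=; apply/subvP => g _.
rewrite -[g]compm1r; apply: lI; rewrite -(subrK (a \oc s \oc p \oc x) (idm T)).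
apply: rpredD => //; apply: (subvP sMI); apply/MP => q.
rewrite -compmA compBm compm1l -!compmA (compmA p) spa compm1r subrr compm0.
exact: mem0v.
Qed.

Lemma nonunit_jacobson r : ~ is_iso r -> a \oc r \oc b \in jacobson T.
Proof.
move=> nr; apply/mem_jacobson => I [lI nIT maxI]; apply: contrapT => nI.
have [|eI|eT] := maxI _ (left_ideal_add_line (x := a \oc r \oc b) lI).
- exact: addvSl.
- apply: nI; rewrite -eI; apply: (subvP (addvSr _ _)).
  by rewrite -[X in X \in _]compm1l mem_compv ?memvf ?memv_line.
have /memv_addP[m mI [_ /compv_linel[y ->] e1]] : idm T \in (I + compv fullv <[a \oc r \oc b]>)%VS.
  by rewrite eT memvf.
have [c [c1 _]] : is_iso (idm X - r \oc (b \oc y \oc a)).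
  by apply/(local_sub1 locX)/(local_nonunitM locX); right.
apply: nIT; apply/eqP; rewrite eqEsubv subvf /=; apply/subvP => g _.
rewrite -[g]compm1r; apply: (lI).
have {e1} em : m = idm T - y \oc (a \oc r \oc b) by rewrite e1 addrK.
(* The left inverse of [m] comes from the identity (1 - pq)^-1 = 1 + p (1 - qp)^-1 q with p =
   [y \oc a] and q = [r \oc b]. *)
have := lI (idm T + y \oc a \oc c \oc r \oc b) _ mI; congr (_ \in I).
rewrite em compDm compm1l compmB compm1r.
rewrite [X in _ + (_ - X)](_ : _ =
  y \oc a \oc c \oc (r \oc (b \oc y \oc a)) \oc r \oc b); last by rewrite !compmA.
move: c1; rewrite compmB compm1r => /(canRL (subrK _)) ec.
have -> : y \oc a \oc c \oc r \oc b =
    y \oc (a \oc r \oc b) + y \oc a \oc c \oc (r \oc (b \oc y \oc a)) \oc r \oc b.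
  rewrite -(compmA (y \oc a) c) [in LHS]ec.
  by rewrite compDm compm1l compmD compDm !compmA.
by rewrite addrK subrK.
Qed.

End Retract.

(** Enlarge [I] to [K]. If [x] in [J] is outside [K], induction puts [J] inside [K] plus the
    multiples of [x]; then [x] is congruent to [j \oc x] modulo [K] with [j] in [J], and [idm X - j]
    is a unit. *)
Lemma nakayama X (J I : {vspace mor X X}) : local_end X ->
  (forall f, f \in J <-> ~ is_iso f) -> left_ideal I ->
  (J <= compv J J + I)%VS -> (J <= I)%VS.
Proof.
move=> locX JP lI sJ.
suff H : forall K, left_ideal K -> (I <= K)%VS -> (J <= K)%VS by exact: H.
apply: vspace_codim_ind => K IH lK sIK; apply/subvP => x xJ.
apply: contrapT => nxK.
have xK' : x \in (K + compv fullv <[x]>)%VS.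
  by apply: (subvP (addvSr _ _)); rewrite -[X in X \in _]compm1l mem_compv ?memvf ?memv_line.
have /subvP sJK : (J <= K + compv fullv <[x]>)%VS.
  apply: IH; first exact: addvSl.
  - by apply/negP => /subvP/(_ x xK').
  - exact: left_ideal_add_line.
  - exact: subv_trans sIK (addvSl _ _).
have JJ : forall z, z \in compv J J -> exists2 j, j \in J & z - j \oc x \in K.
  apply: compv_ind => [|c z z' [j jJ jK] [j' jJ' jK']|g f gJ fJ].
  - by exists 0; rewrite ?mem0v // comp0m subr0 mem0v.
  - exists (c *: j + j'); first by rewrite rpredD ?rpredZ.
    by rewrite compDm compZm opprD addrACA -scalerBr rpredD ?rpredZ.
  - have /memv_addP[w wK [_ /compv_linel[y ->] ->]] := sJK _ fJ.
    exists (g \oc y); last by rewrite compmD compmA addrK; exact: lK.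
    by apply/JP/(local_nonunitM locX); right; apply/JP.
have /memv_addP[z /JJ[j jJ zK] [w wI ex]] := subvP sJ _ xJ.
apply: nxK; have [s [s1 _]] : is_iso (idm X - j) by apply/(local_sub1 locX)/JP.
rewrite -[x]compm1l -s1 -compmA; apply: lK.
rewrite compBm compm1l {1}ex addrAC; apply: rpredD => //; exact: (subvP sIK).
Qed.

(** Without a loop at [i], the radical of End(F i) lies in its own square plus maps through [M], and
    Nakayama removes the square. *)
Lemma no_loop_thru n (F : 'I_n -> C) T (d : dirsum F T) i M :
  local_end (F i) -> arrows d i i = 0%N -> idm T - idem d i \in thru M T T ->
  forall r, ~ is_iso r -> r \in thru M (F i) (F i).
Proof.
move=> locF loop0 oneM; have [J JP] := local_nonunits locF.
set a := dinj d i; set b := dprj d i; have ba : b \oc a = idm (F i) := dprj_inj d i.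
have be : b \oc idem d i = b by rewrite compmA ba compm1l.
have ea : idem d i \oc a = a by rewrite -compmA ba compm1r.
suff /subvP H : (J <= thru M (F i) (F i))%VS by move=> r /JP/H.
apply: (nakayama locF JP) => [f g|]; first exact: thru_compl.
have sJJ : (compv (jacobson T) (jacobson T) <= jacobson T)%VS.
  apply/subvP; apply: compv_ind => [|c u v uJ vJ|g f _ /mem_jacobson fJ].
  - exact: mem0v.
  - by rewrite rpredD ?rpredZ.
  - by apply/mem_jacobson => I maxI; have [lI _ _] := maxI; apply/lI/fJ.
(* [arrows] is a truncated difference, so its vanishing bounds one dimension by the other; the
   inclusion turns this into equality. *)
have eC : corner d (compv (jacobson T) (jacobson T)) i i = corner d (jacobson T) i i.
  apply/eqP; rewrite eqEdim -subn_eq0 -/(arrows d i i) loop0 eqxx andbT.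
  by apply: compvS => //; exact: compvS.
apply/subvP => r /JP/(nonunit_jacobson a b locF) rJ.
have -> : r = b \oc (a \oc r \oc b) \oc a.
  by rewrite !compmA ba compm1l -compmA ba compm1r.
have : a \oc r \oc b \in corner d (jacobson T) i i.
  have -> : a \oc r \oc b = idem d i \oc (a \oc r \oc b \oc idem d i).
    by rewrite -[_ \oc b \oc _]compmA be !compmA ea.
  by apply: mem_compv; [|apply: mem_compv]; rewrite ?memv_line.
rewrite -eC; move: (a \oc r \oc b).
have lin c x y : b \oc x \oc a \in (compv J J + thru M (F i) (F i))%VS ->
    b \oc y \oc a \in (compv J J + thru M (F i) (F i))%VS ->
    b \oc (c *: x + y) \oc a \in (compv J J + thru M (F i) (F i))%VS.
  by move=> Hx Hy; rewrite compmD compmZ compDm compZm rpredD ?rpredZ.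
have zero : b \oc 0 \oc a \in (compv J J + thru M (F i) (F i))%VS.
  by rewrite compm0 comp0m mem0v.
apply: (compv_ind zero lin) => _ x /vlineP[c ->] xC.
rewrite compZm compmZ compZm rpredZ // compmA be.
move: x xC; apply: (compv_ind zero lin) => x _ xJ /vlineP[c' ->].
rewrite !compmZ compZm rpredZ // (compmA b) -(compmA _ (idem d i)) ea.
move: x xJ; apply: (compv_ind zero lin) => g f gJ fJ.
(* The identity of [T] is inserted between [g] and [f] and split into [idem d i] and its
   complement. *)
have -> : b \oc (g \oc f) \oc a = (b \oc g \oc a) \oc (b \oc f \oc a)
    + b \oc g \oc (idm T - idem d i) \oc (f \oc a).
  by rewrite compmB compm1r compBm !compmA addrC subrK.
apply: memv_add; last exact/thru_compr/thru_compl.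
by apply: mem_compv; apply/JP; exact: jacobson_nonunit.
Qed.

End Radical.

Section Basic.
Variables (k : fieldType) (C : linCat k).
Implicit Types L Tb T : C.

(** Modulo nonunits, composites from [L] to [L] through [T] only see the summand [F i] isomorphic to
    [L]. A second copy of [L] in [Tb] would make [bprl b \oc (binr b \oc s)] a unit, but it is
    zero. *)
Lemma basic_not_retract L Tb T n (F : 'I_n -> C) (d : dirsum F T) :
  local_end L -> (forall i, local_end (F i)) ->
  (forall i j, F i ~= F j -> i = j) -> biprod L Tb T -> ~ retract L Tb.
Proof.
move=> locL locF Finj b [s [p ps]]; have [J JP] := local_nonunits locL.
have [i /(local_retract_iso locL (locF i)) LFi] :=
  local_dirsum locL d (biprod_retractl b).
have offi j (x : mor L (F j)) (y : mor (F j) L) : j != i -> y \oc x \in J.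
  move=> /eqP ji; apply/JP => -[g [gyx _]]; apply: ji; apply: Finj.
  apply: iso_trans LFi; apply/iso_sym/(local_retract_iso locL (locF j)).
  by exists x, (g \oc y); rewrite -compmA.
have ati (x : mor L T) (y : mor T L) : (y \oc dinj d i) \oc (dprj d i \oc x) - y \oc x \in J.
  rewrite -[X in _ - _ \oc X](compm1l x) -(dinj_prj d) comp_suml comp_sumr (bigD1 i) //=.
  rewrite !compmA opprD addrA subrr add0r.
  rewrite rpredN; apply: rpred_sum => j ji.
  by rewrite -compmA compmA; exact: offi.
have unit (x : mor L T) (y : mor T L) : y \oc x = idm L ->
    is_iso (dprj d i \oc x) /\ is_iso (y \oc dinj d i).
  move=> yx; have [g [g1 g2]] : is_iso ((y \oc dinj d i) \oc (dprj d i \oc x)).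
    apply: contrapT => /JP nJ; have := rpredB nJ (ati x y).
    by rewrite subKr yx => /JP; case; exact: is_iso_id.
  rewrite compmA in g1; rewrite -compmA in g2.
  have i1 := local_section_inv locL (locF i) g1.
  have i2 := local_section_inv locL (locF i) g2.
  by split; [exists (g \oc (y \oc dinj d i)) | exists (dprj d i \oc x \oc g)].
have [_ u1] := unit _ _ (bprl_inl b).
have [|u2 _] := unit (binr b \oc s) (p \oc bprr b).
  by rewrite compmA -(compmA p) bprr_inr compm1r.
have := ati (binr b \oc s) (bprl b).
rewrite (compmA (bprl b)) bprl_inr comp0m subr0 => /JP; case; exact: is_iso_comp.
Qed.

(** Transport [no_loop_thru] along the isomorphism of [L] with some [F i]; the other summands of [T]
    are retracts of [Tb]. *)
Lemma no_loops_radical L Tb T n (F : 'I_n -> C) (d : dirsum F T) :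
  local_end L -> (forall i, local_end (F i)) ->
  (forall i j, F i ~= F j -> i = j) -> biprod L Tb T -> no_loops d ->
  forall r : mor L L, ~ is_iso r -> r \in thru Tb L L.
Proof.
move=> locL locF Finj b nld r nr.
have [i /(local_retract_iso locL (locF i)) LFi] :=
  local_dirsum locL d (biprod_retractl b).
have [t [t' [t't tt']]] := LFi.
have -> : r = t' \oc (t \oc r \oc t') \oc t.
  by rewrite !compmA t't compm1l -compmA t't compm1r.
apply/thru_compr/thru_compl/(no_loop_thru (locF i) (nld i)) => [|u].
  rewrite -(dinj_prj d) (bigD1 i) //= addrC addrK.
  apply: rpred_sum => j /eqP ji; apply: (inadd_thru (Y := F j)); last exact: mem_thru.
  have [FL|FTb] := local_biprod (locF j) b (dirsum_retract d j); last exact: inadd_retract.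
  case: ji; apply: Finj; apply: iso_trans LFi; exact: local_retract_iso.
apply: nr; have -> : r = t' \oc (t \oc r \oc t') \oc t.
  by rewrite !compmA t't compm1l -compmA t't compm1r.
by apply: is_iso_comp; [apply: is_iso_comp => //; exists t | exists t'].
Qed.

End Basic.

Import VectorInternalTheory.

(** Left composition with [f] on the nonzero space End(X) has an eigenvalue [a], and
    [f - a *: idm X] kills an eigenvector. *)
Lemma closed_eigen (k : closedFieldType) (C : linCat k) (X : C) (f : mor X X) :
  local_end X -> exists a, ~ is_iso (f - a *: idm X).
Proof.
move=> [X0 _]; set V := mor X X.
pose F : {linear V -> V} :=
  HB.pack (fun g => f \oc g) (GRing.isLinear.Build k V V _ _ (compm_linearr (X := X) f)).
pose A := lin1_mx (v2r \o F \o r2v).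
have [a] : exists a, root (char_poly A) a.
  apply/closed_rootP; rewrite size_char_poly; apply/eqP => -[V0].
  apply: X0; apply/eqP; rewrite -memv0 (_ : 0%VS = fullv) ?memvf //.
  by apply/eqP; rewrite eq_sym -dimv_eq0 dimvf V0.
rewrite -eigenvalue_root_char => /eigenvalueP[v vA v0]; exists a => -[h [h1 _]].
case/negP: v0; rewrite -(can_eq r2vK) linear0 -[r2v v]compm1l -h1 -compmA compBm.
move: vA; rewrite mul_rV_lin1 /= => /(congr1 r2v); rewrite v2rK linearZ /= => ->.
by rewrite compZm compm1l subrr compm0.
Qed.

(** * Extensions in an exchange pair *)

Section ExchangeDim.
Variables (k : closedFieldType) (C : triCat k).
Implicit Types L N Tb T : C.
Hypotheses (ksC : krull_schmidt C) (cyC : two_calabi_yau C).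

Lemma cluster_scalar L Tb T : cluster_structure C -> indecomposable L ->
  biprod L Tb T -> basic T -> cluster_tilting T ->
  ~ retract L Tb /\ forall r : mor L L, exists a, r - a *: idm L \in thru Tb L L.
Proof.
move=> [nlC _] indL b [n [F [[d] basF]]] ctT; have [indF Finj] := basF.
have locL := indecomposable_local ksC indL.
have locF i := indecomposable_local ksC (indF i).
split; first exact: (basic_not_retract d locL locF Finj b).
move=> r; have [a na] := closed_eigen r locL; exists a.
by apply: (no_loops_radical locL locF Finj b (nlC _ _ _ d ctT basF).1).
Qed.

Lemma dim1_of_exchange_pair L N : cluster_structure C ->
  exchange_pair L N -> \dim {: mor N (susp L)} = 1%N.
Proof.
move=> clC [Tb [T [T2 [[indL indN] [[b] [b2]] [basT ctT] [basT2 ctT2] nLN]]]].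
have [locL locN] := (indecomposable_local ksC indL, indecomposable_local ksC indN).
have [nLTb scalL] := cluster_scalar clC indL b basT ctT.
have [_ scalN] := cluster_scalar clC indN b2 basT2 ctT2.
have [[rigT maxT] [rigT2 maxT2]] := (ctT, ctT2).
have sub (A B Z : C) : rigid Z -> retract A Z -> retract B Z -> ext0 A B.
  move=> rigZ /inadd_retract ZA /inadd_retract ZB.
  by apply: (ext0_inaddr ZB); exact: (ext0_inaddl ZA).
have LL : ext0 L L := sub _ _ _ rigT (biprod_retractl b) (biprod_retractl b).
have LTb : ext0 L Tb := sub _ _ _ rigT (biprod_retractl b) (biprod_retractr b).
have TbL : ext0 Tb L := ext0_sym cyC LTb.
have NN : ext0 N N := sub _ _ _ rigT2 (biprod_retractl b2) (biprod_retractl b2).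
have NTb : ext0 N Tb := sub _ _ _ rigT2 (biprod_retractl b2) (biprod_retractr b2).
set V : {vspace mor N (susp L)} := fullv; pose e := vbasis V.
have e0 i : (i < \dim V)%N -> e`_i != 0.
  by move=> im; apply: (basis_not0 (vbasisP V)); rewrite mem_nth ?size_tuple.
have [A [dA]] := dirsum_ex (fun _ : 'I_(\dim V) => L).
have LA : inadd L A by apply: (inadd_dirsum dA) => _; exact: inadd_refl.
(* The universal extension, whose components are a basis of Ext(N, L). *)
pose h : mor N (susp A) := \sum_(i < \dim V) suspm (dinj dA i) \oc e`_i.
have hP i : suspm (dprj dA i) \oc h = e`_i.
  rewrite comp_sumr (bigD1 i) //= big1 => [|j ji].
    by rewrite addr0 compmA -suspmM dprj_inj suspm1 compm1l.
  by rewrite compmA -suspmM dprj_inj0 // suspm0 comp0m.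
have [D [u [v TD]]] := dtri_cocone h.
have DL : ext0 D L.
  move=> f; have [|g ->] := dtri_liftr TD (f := f); first exact: (ext0_inaddl LA).
  rewrite (coord_vbasis (memvf g)) comp_suml big1 // => i _.
  by rewrite compZm -[X in X \oc v]hP -compmA (dtri_comp0r TD) compm0 scaler0.
have DTb : ext0 D Tb := ext0_dtril TD (ext0_inaddl LA LTb) NTb.
have TaddD : inadd T D.
  by apply/in_addP/maxT/(ext0_sym cyC)/(ext0_biprodr b).
(* On the [i]-th copy of [L], [p \oc u] is a scalar [a i] modulo maps through [Tb]. Composing with
   [h] gives a linear relation between the basis vectors, so all scalars vanish. *)
have scal0 (p : mor D L) : p \oc u \in thru Tb A L.
  have eq0 : \sum_(i < \dim V) suspm (p \oc u \oc dinj dA i) \oc e`_i = 0.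
    transitivity (suspm p \oc (suspm u \oc h)); last by rewrite (dtri_comp0s TD) compm0.
    by rewrite !comp_sumr; apply: eq_bigr => i _; rewrite !suspmM !compmA.
  rewrite -[u]compm1r -(dinj_prj dA) !comp_sumr; apply: rpred_sum => i _.
  rewrite !compmA; apply: thru_compr.
  have [a ea] := choice (fun i => scalL (p \oc u \oc dinj dA i)).
  have : \sum_(i < \dim V) a i *: e`_i = 0.
    rewrite -[RHS]eq0; apply: eq_bigr => j _; apply/eqP; rewrite -subr_eq0 -opprB oppr_eq0.
    rewrite -[X in _ - _ *: X]compm1l -compZm -suspm1 -suspmZ -compBm -suspmN -suspmD.
    by apply/eqP; apply: thru_ext0r (ea j) NTb.
  have /freeP fr := basis_free (vbasisP V); move=> /fr/(_ i) ai0.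
  by have := ea i; rewrite ai0 scale0r subr0.
(* The identity of [D] factors through [L] and [Tb]. A map [p] to [L] agrees on [u] with some [q]
   through [Tb], and [p - q] factors through [N]; Ext(N, Tb) and Ext(N, N) are zero. *)
have ND : ext0 N D.
  move=> x; rewrite -[x]compm1l -suspm1.
  have [y [z [yL zTb ->]]] := biprod_thru b TaddD.
  rewrite suspmD compDm (thru_ext0r _ zTb NTb) addr0.
  move: y yL; apply: thru_ind => [|c y z' Hy Hz|g p].
  - by rewrite suspm0 comp0m.
  - by rewrite suspmD suspmZ compDm compZm Hy Hz scaler0 add0r.
  have [q qTb equ] : exists2 q, q \in thru Tb D L & p \oc u = q \oc u.
    move: (p \oc u) (scal0 p); apply: thru_ind => [|c y z' [q qP ->] [q' q'P ->]|g' f].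
    - by exists 0; rewrite ?mem0v // comp0m.
    - exists (c *: q + q'); first by rewrite rpredD ?rpredZ.
      by rewrite compDm compZm.
    - have [|f' ->] := dtri_extend TD (f := f); first exact: NTb.
      by exists (g' \oc f'); rewrite ?mem_thru ?compmA.
  have [|w ew] := dtri_liftr TD (f := p - q); first by rewrite compBm equ subrr.
  rewrite suspmM -compmA -(subrK q p) ew suspmD compDm (thru_ext0r _ qTb NTb) addr0.
  by rewrite suspmM -compmA [suspm v \oc x]NN !compm0.
(* Were Ext(N, L) zero, [L] would be a summand of [T2], hence isomorphic to [N] or a summand of
   [Tb]. *)
apply/eqP; rewrite eqn_leq andbC lt0n; apply/andP; split.
  apply/negP; rewrite dimv_eq0 => /eqP V0.
  have NL : ext0 N L by move=> f; apply/eqP; rewrite -memv0 -V0 memvf.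
  have /in_addP T2L : in_add T2 L by apply: maxT2; apply: (ext0_biprodl b2).
  have [LN|//] := local_biprod locL b2 (local_inadd locL T2L).
  exact/nLN/local_retract_iso.
rewrite leqNgt; apply/negP => m2.
pose i0 := Ordinal (ltnW m2); pose i1 := Ordinal m2.
(* This class has only one nonzero component. Lifting it through [h] makes it a multiple of [h];
   component [i1] forces the factor to be zero, and component [i0] then contradicts the basis. *)
pose x := suspm (dinj dA i0) \oc e`_i0.
have [|g eg] := dtri_liftl2 TD (f := x); first exact: ND.
have [a ag] := scalN g.
have {eg} ex : x = a *: h.
  rewrite eg -(subrK (a *: idm N) g) compmD (thru_ext0l _ ag (ext0_inaddr LA TbL)) add0r.
  by rewrite compmZ compm1r.
have a0 : a = 0.
  have := congr1 (fun y => suspm (dprj dA i1) \oc y) ex.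
  rewrite /= compmZ hP compmA -suspmM dprj_inj0 // suspm0 comp0m => /esym/eqP.
  by rewrite scaler_eq0 (negPf (e0 1%N _)) // orbF => /eqP.
have := congr1 (fun y => suspm (dprj dA i0) \oc y) ex.
rewrite /= a0 scale0r compm0 compmA -suspmM dprj_inj suspm1 compm1l => /eqP.
by rewrite (negPf (e0 0%N _)) // ltnW.
Qed.

End ExchangeDim.

Theorem theorem5p8 (k : closedFieldType) (C : triCat k)
    (ksC : krull_schmidt C)
    (cyC : two_calabi_yau C)
    (ctC : exists T : C, cluster_tilting T)
    (L N : C)
    (indL : indecomposable L) (rigL : rigid L)
    (indN : indecomposable N) (rigN : rigid N) :
  (\dim {: mor L (susp N)} = 1%N -> exchange_pair L N) /\
  (cluster_structure C ->
   (\dim {: mor L (susp N)} = 1%N <-> exchange_pair L N)).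
Proof.
have exch : \dim {: mor L (susp N)} = 1%N -> exchange_pair L N.
  exact: exchange_pair_of_dim1.
split=> // clC; split=> // /(dim1_of_exchange_pair ksC cyC clC).
by rewrite dim_ext_sym.
Qed.
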